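(* Let $\mathfrak D$ be the cluster scattering diagram in $M^\circ_{\mathbb R}$ of a cluster variety of type $\mathcal A$ for which $p_1^*$ is injective. Let $\tilde\gamma:[0,T]\to M^\circ_{\mathbb R}$ be a broken line segment with endpoints $\tilde\gamma(0)=\tilde p$ and $\tilde\gamma(T)=\tilde q$ in $M^\circ_{\mathbb Q}$, let $\tau$ be a rational number in $(0,T)$ with $\tilde\gamma(\tau)\in M^\circ_{\mathbb Q}$, and let $(a,b)$ be a pair of positive integers with $\frac{b}{a+b}=\frac{\tau}{T}$, $a\tilde p\in\tilde\rho_0^{(1)}M^\circ$ and $b\tilde q\in\tilde\rho_0^{(2)}M^\circ$. Then there is a pair of broken lines $(\gamma^{(1)},\gamma^{(2)})$ balanced at $(a+b)\tilde\gamma(\tau)$ with $I(\gamma^{(1)})=a\tilde p$ and $I(\gamma^{(2)})=b\tilde q$.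
   Context: **Fixed data.** A finite set $I$ with a subset $I_{\mathrm{uf}}$; a lattice $N$ of rank $|I|$; a saturated sublattice $N_{\mathrm{uf}}\subseteq N$ of rank $|I_{\mathrm{uf}}|$; a skew-symmetric bilinear form $\{\cdot,\cdot\}:N\times N\to\mathbb Q$; a finite index sublattice $N^\circ\subseteq N$ with $\{N_{\mathrm{uf}},N^\circ\}\subset\mathbb Z$, $\{N,N_{\mathrm{uf}}\cap N^\circ\}\subset\mathbb Z$; positive integers $(d_i)_{i\in I}$ with gcd $1$; $M^\circ=\mathrm{Hom}(N^\circ,\mathbb Z)$, $M^\circ_{\mathbb Q}=M^\circ\otimes\mathbb Q$, $M^\circ_{\mathbb R}=M^\circ\otimes\mathbb R$. A seed: a basis $(e_i)_{i\in I}$ of $N$ with $(e_i)_{i\in I_{\mathrm{uf}}}$ a basis of $N_{\mathrm{uf}}$ and $(d_ie_i)$ a basis of $N^\circ$. $p_1^*:N_{\mathrm{uf}}\to M^\circ$, $n\mapsto\{n,\cdot\}$, is assumed injective. $N^+=\{\sum_{i\in I_{\mathrm{uf}}}a_ie_i:a_i\in\mathbb Z_{\ge0},\sum a_i>0\}$. $P$ is the monoid of integral points of a full dimensional strictly convex rational polyhedral cone in $M^\circ_{\mathbb R}$ containing all $p_1^*(e_i)$, $i\in I_{\mathrm{uf}}$; $J=P\setminus\{0\}$; $\widehat{\mathbb C[P]}$ is the $J$-adic completion. **Scattering diagram.** A wall is a pair $(\mathfrak d,f_{\mathfrak d})$ with $\mathfrak d\subseteq n^\perp\subset M^\circ_{\mathbb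 R}$ a convex rational polyhedral cone of codimension one, $n\in N^+$, $f_{\mathfrak d}=1+\sum_{k\ge1}c_kz^{kp_1^*(n)}\in\widehat{\mathbb C[P]}$; incoming if $p_1^*(n)\in\mathfrak d$, otherwise outgoing. A scattering diagram is a collection of walls with finitely many $f_{\mathfrak d}\not\equiv1$ mod $J^k$ for each $k$. $\mathrm{Supp}(\mathfrak D)=\bigcup\mathfrak d$; $\mathrm{Sing}(\mathfrak D)$ is the union of all $\partial\mathfrak d$ and all codimension two intersections $\mathfrak d_1\cap\mathfrak d_2$. Crossing walls by a path $\gamma$ at time $t$ acts by $z^m\mapsto z^mf_{\mathfrak d}^{\epsilon\langle n_0',m\rangle}$, $n_0'$ the generator of $\mathbb R_{\ge0}n\cap N^\circ$, $\epsilon=-\mathrm{sgn}\langle n,\gamma'(t)\rangle$; $\mathfrak D$ is consistent if path ordered products of these depend only on endpoints of paths. The cluster scattering diagram is the consistent diagram, unique up to equivalence (equality of path ordered products), consisting of the walls $(e_i^\perp,1+z^{p_1^*(e_i)})$, $i\in I_{\mathrm{uf}}$, and otherwise only outgoing walls, with representative chosen so that all $f_{\mathfrak d}=(1+z^{p_1^*(n)})^c$, $n\in N^+$, $c\in\mathbb Z_{>0}$. **Broken lines.** A generic broken line with initial exponent $\mathfrak m\in M^\circ\setminus\{0\}$ and endpoint $x_0\notin\mathrm{Supp}(\mathfrak D)$ is a continuous proper piecewise linear path $\gamma:(-\infty,0]\to M^\circ_{\mathbb R}\setminus\mathrm{Sing}(\mathfrak D)$, $\gamma(0)=x_0$, bending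 only at walls, with finitely many domains of linearity $L$, each with a monomial $c_Lz^{\mathfrak m_L}$, such that: the unbounded domain carries $z^{\mathfrak m}$; $\gamma'=-\mathfrak m_L$ on $L$; if $\gamma$ bends from $L$ to $L'$ at time $t$, then $c_{L'}z^{\mathfrak m_{L'}}$ is a term of the image of $c_Lz^{\mathfrak m_L}$ under the crossing automorphism of all walls containing $\gamma(t)$. $I(\gamma)=\mathfrak m$, and $F(\gamma)$ is the exponent of the last domain of linearity. A non-generic broken line is a piecewise linear ray $\gamma:(-\infty,0]\to M^\circ_{\mathbb R}$ with $\gamma(0)\in\mathrm{Supp}(\mathfrak D)$ or image meeting $\mathrm{Sing}(\mathfrak D)$, together with a sequence of generic broken lines $(\gamma_k)$ converging pointwise to $\gamma$, all with the same initial exponent, bending at the same walls in the same order and with the same decorating monomials. Its bending points and domains of linearity are the limits of those of the $\gamma_k$ (bending points may coincide; domains degenerate to points are still recorded with their exponents); $I(\gamma)$, $F(\gamma)$ are those of the $\gamma_k$. A broken line is a generic or non-generic one; a generic one may also be viewed with a constant defining sequence. A segment of a broken line is its restriction to a closed interval, reparametrized by translation as $\tilde\gamma:[0,T]\to M^\circ_{\mathbb R}$; it inherits bending points, domains of linearity and exponents. **Balanced pairs.** A pair of generic broken lines is based if the two have the same endpoint. A pair $(\gamma^{(1)},\gamma^{(2)})$ of broken lines is based if every pair $(\gamma_k^{(1)},\gamma_k^{(2)})$ of the defining sequences is based. It is balanced at $x$ if it is based, $\gamma^{(1)}(0)=\gamma^{(2)}(0)=x$ and $F(\gamma^{(1)})+F(\gamma^{(2)})=x$.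 **The integers $\tilde\rho_0^{(\epsilon)}$.** Let $\tilde x_1,\dots,\tilde x_s$ be the bending points of $\tilde\gamma$ in order of increasing time, at times $t_1\le\dots\le t_s$, and let $\widetilde{\mathfrak m}_0,\dots,\widetilde{\mathfrak m}_s$ be the exponents of the successive domains of linearity $\tilde L_0,\dots,\tilde L_s$. Let $\ell=\#\{j:t_j<\tau\}$, $s_1=\ell$, $s_2=s-\ell$ (so a bend occurring at time $\tau$ is assigned to side $(2)$). Put $\tilde x_i^{(1)}=\tilde x_{\ell+1-i}$, $\tilde x_i^{(2)}=\tilde x_{\ell+i}$, $\widetilde{\mathfrak m}_i^{(1)}=\widetilde{\mathfrak m}_{\ell-i}$, $\widetilde{\mathfrak m}_i^{(2)}=\widetilde{\mathfrak m}_{\ell+i}$, and let $n_{0,i}^{(\epsilon)}\in N^\circ$ be a primitive vector orthogonal to the walls at which the bend at $\tilde x_i^{(\epsilon)}$ takes place. Then $\tilde\rho_0^{(\epsilon)}=\prod_{k=1}^{s_\epsilon}\langle n_{0,k}^{(\epsilon)},\widetilde{\mathfrak m}_k^{(\epsilon)}\rangle$ for $\epsilon=1,2$ (only its absolute value matters).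
   Formalization: The endpoints p̃ and q̃ are assumed nonzero, since initial exponents of broken lines must be nonzero and the claim fails otherwise (a straight segment ending at the origin); the degenerate case of empty I_uf, with no walls, is excluded. *)

(* Defs.v *)
From HB Require Import structures.
From mathcomp Require Import all_boot all_order all_algebra.
From mathcomp Require Import all_classical all_reals all_analysis.
From mathcomp.real_closed Require Import complex.
Set Implicit Arguments.
Unset Strict Implicit.
Unset Printing Implicit Defensive.
Import Order.TTheory GRing.Theory Num.Theory.
Import numFieldNormedType.Exports.
Local Open Scope classical_set_scope.
Local Open Scope ring_scope.

(** * Lattices *)

(* The seed basis (e_i) identifies N with Z^n and I with {0, ..., n-1}: an
   element of N is the row of its coordinates in (e_i), and [skew] is the matrix
   ({e_i, e_j}). Then N_uf, spanned by the unfrozen e_i, and N°, spanned by the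
   d_i e_i, are the subsets [Nuf_of] and [Ncirc_of] below. *)
Definition Nuf_of n (uf : {set 'I_n}) (v : 'rV[int]_n) : Prop :=
  forall i, i \notin uf -> v 0 i = 0.

Definition Ncirc_of n (d : 'I_n -> nat) (v : 'rV[int]_n) : Prop :=
  forall i : 'I_n, ((d i)%:Z %| v ord0 i)%Z.

Definition form_of n (B : 'M[rat]_n) (u v : 'rV[int]_n) : rat :=
  \sum_i \sum_j (u 0 i)%:~R * B i j * (v 0 j)%:~R.

(* An element of M° = Hom(N°, Z) is the row of its values on the basis (d_i e_i)
   of N°. When {v, d_i e_i} is an integer, [numq] returns that integer. *)
Definition p1_of n (d : 'I_n -> nat) (B : 'M[rat]_n) (v : 'rV[int]_n) :
    'rV[int]_n :=
  \row_i numq (form_of B v (delta_mx 0 i *+ d i)).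

Record seed := Seed {
  rk : nat;
  uf : {set 'I_rk};
  mult : 'I_rk -> nat;
  skew : 'M[rat]_rk;
  mult_gt0 : forall i, (0 < mult i)%N;
  mult_gcd : \big[gcdn/0%N]_(i < rk) mult i = 1%N;
  skewP : skew^T = - skew;
  form_uf_circ : forall u v, Nuf_of uf u -> Ncirc_of mult v ->
    form_of skew u v \is a Num.int;
  form_all_ufcirc : forall u v, Nuf_of uf v -> Ncirc_of mult v ->
    form_of skew u v \is a Num.int;
  p1_inj : forall u v, Nuf_of uf u -> Nuf_of uf v ->
    p1_of mult skew u = p1_of mult skew v -> u = v }.

Definition lattice (S : seed) := 'rV[int]_(rk S).
Definition MR (R : realType) (S : seed) := 'rV[R]_(rk S).

Definition Ncirc (S : seed) : lattice S -> Prop := Ncirc_of (@mult S).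
Definition Nplus (S : seed) (v : lattice S) : Prop :=
  [/\ Nuf_of (uf S) v, forall i, 0 <= v 0 i & 0 < \sum_i v 0 i].
Definition basis_vec (S : seed) (i : 'I_(rk S)) : lattice S := delta_mx 0 i.
Definition p1 (S : seed) : lattice S -> lattice S := p1_of (@mult S) (skew S).

Definition toR (R : realType) (S : seed) (m : lattice S) : MR R S :=
  map_mx intr m.

Definition rational_point (R : realType) (S : seed) (x : MR R S) : Prop :=
  exists v : 'rV[rat]_(rk S), x = map_mx ratr v.

(* As e_i = (d_i e_i) / d_i, pairing with e_i is the i-th coordinate over d_i. *)
Definition pairR (R : realType) (S : seed) (v : lattice S) (x : MR R S) : R :=
  \sum_i (v 0 i)%:~R / (mult i)%:R * x 0 i.

(* The pairing N° x M° -> Z: the divisions are exact for v in N°. *)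
Definition pairZ (S : seed) (v m : lattice S) : int :=
  \sum_i (v ord0 i %/ (mult i)%:Z)%Z * m 0 i.

Definition perp (R : realType) (S : seed) (v : lattice S) : set (MR R S) :=
  [set x | pairR v x = 0].

Definition primitive (S : seed) (v : lattice S) : Prop :=
  Ncirc v /\ forall (k : int) (u : lattice S), Ncirc u -> v = k *: u -> `|k| = 1.

Definition ray_monoid (R : realType) (S : seed) (v : lattice S) :
    set (lattice S) :=
  [set u | Ncirc u /\ exists2 r : R, 0 <= r & toR R u = r *: toR R v].

Definition ray_gen (R : realType) (S : seed) (v : lattice S) : lattice S :=
  xget 0 [set g | ray_monoid R v = range (fun k : nat => g *+ k)].

(** * Cones *)

Definition rational_cone (R : realType) (S : seed) (A : set (MR R S)) : Prop :=
  exists k (G : 'M[int]_(k, rk S)),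
    A = [set x | exists2 c : 'rV[R]_k,
           forall j, 0 <= c 0 j & x = c *m map_mx intr G].

(* The linear span of A has dimension r. *)
Definition has_dim (R : realType) (S : seed) (A : set (MR R S)) (r : nat) :
    Prop :=
  exists B : 'M[R]_(r, rk S),
    [/\ row_free B, forall i, A (row i B) & forall x, A x -> (x <= B)%MS].

Definition monoid_cone (R : realType) (S : seed) (C : set (MR R S)) : Prop :=
  [/\ rational_cone C, has_dim C (rk S),
      forall x, C x -> C (- x) -> x = 0 &
      forall i, i \in uf S -> C (toR R (p1 (basis_vec i)))].

(** * Formal series *)

(* [pmon C] is P, and [Jpow C k] is the set of exponents of the monomials
   spanning the ideal J^k, with J^0 = C[P]. *)
Definition pmon (R : realType) (S : seed) (C : set (MR R S)) (m : lattice S) :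
    Prop :=
  C (toR R m).

Fixpoint Jpow (R : realType) (S : seed) (C : set (MR R S)) (k : nat)
    (m : lattice S) : Prop :=
  if k is k'.+1 then
    exists u v, [/\ pmon C u, u != 0, Jpow C k' v & m = u + v]
  else pmon C m.

(* One-variable power series over the complex numbers. *)
Definition psone (R : realType) : nat -> R[i] := fun k => (k == 0%N)%:R.
Definition psmul (R : realType) (f g : nat -> R[i]) : nat -> R[i] :=
  fun k => \sum_(j < k.+1) f j * g (k - j)%N.
Definition psexp (R : realType) (f : nat -> R[i]) (e : nat) : nat -> R[i] :=
  iter e (psmul f) (psone R).

(* For f with constant term 1: the geometric series in 1 - f. *)
Definition psinv (R : realType) (f : nat -> R[i]) : nat -> R[i] :=
  fun k => \sum_(j < k.+1) psexp (fun l => psone R l - f l) j k.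

Definition pszexp (R : realType) (f : nat -> R[i]) (e : int) : nat -> R[i] :=
  match e with
  | Posz k => psexp f k
  | Negz k => psexp (psinv f) k.+1
  end.

Definition ps1X (R : realType) : nat -> R[i] := fun k => (k <= 1)%N%:R.

(* A formal sum of monomials z^m, given by its coefficients. The completion of
   C[P] consists of those supported in P; as P has finitely many elements
   outside each J^k, every function supported in P does occur. *)
Definition fseries (R : realType) (S : seed) := lattice S -> R[i].
Definition monomial (R : realType) (S : seed) (c : R[i]) (m : lattice S) :
    fseries R S :=
  fun m' => if m' == m then c else 0.

(** * Scattering diagrams *)

(* [wser] is the sequence (c_k) with f = 1 + sum_(k >= 1) c_k z^(k p1*(n)),
   n = [wnormal], with c_0 = 1. *)
Record wall (R : realType) (S : seed) := Wall {
  wsupp : set (MR R S);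
  wnormal : lattice S;
  wser : nat -> R[i] }.

Definition is_wall (R : realType) (S : seed) (w : wall R S) : Prop :=
  [/\ Nplus (wnormal w), wsupp w `<=` perp (wnormal w), rational_cone (wsupp w),
      exists2 r, r.+1 = rk S & has_dim (wsupp w) r & wser w 0%N = 1].

Definition incoming (R : realType) (S : seed) (w : wall R S) : Prop :=
  wsupp w (toR R (p1 (wnormal w))).

Definition one_mod (R : realType) (S : seed) (C : set (MR R S)) (k : nat)
    (w : wall R S) : Prop :=
  forall j : nat, (0 < j)%N -> wser w j != 0 -> Jpow C k (p1 (wnormal w) *+ j).

(* A collection of walls is a family, so that repetitions are allowed. *)
Definition scattering_diagram (R : realType) (S : seed) (C : set (MR R S))
    (W : choiceType) (D : W -> wall R S) : Prop :=
  (forall w, is_wall (D w)) /\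
  (forall k, finite_set [set w | ~ one_mod C k (D w)]).

Definition Supp (R : realType) (S : seed) (W : choiceType) (D : W -> wall R S) :
    set (MR R S) :=
  \bigcup_w wsupp (D w).

(* A wall has codimension one, so its span is the hyperplane orthogonal to its
   normal and its boundary is taken in that hyperplane. *)
Definition wboundary (R : realType) (S : seed) (w : wall R S) : set (MR R S) :=
  wsupp w `&` closure (perp (wnormal w) `\` wsupp w).

Definition Sing (R : realType) (S : seed) (W : choiceType) (D : W -> wall R S) :
    set (MR R S) :=
  (\bigcup_w wboundary (D w)) `|`
  [set x | exists w1 w2, let A := wsupp (D w1) `&` wsupp (D w2) in
     A x /\ exists2 r, r.+2 = rk S & has_dim A r].

(* Crossing w with velocity v, extended to formal sums: the term a_m z^m
   contributes a_m [f^e]_j to the coefficient of m + j p1*(n), where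
   e = eps <n_0', m>. The sum over j is finite for series supported in a
   translate of P. *)
Definition wall_cross (R : realType) (S : seed) (w : wall R S) (v : MR R S)
    (a : fseries R S) : fseries R S :=
  let eps : int := - sgz (pairR (wnormal w) v) in
  let n0 := ray_gen R (wnormal w) in
  fun m' => \sum_(j \in [set: nat])
    (let m := m' - p1 (wnormal w) *+ j in
     a m * pszexp (wser w) (eps * pairZ n0 m) j).

(* Smooth immersed paths on [0, 1], given as restrictions of smooth maps on R. *)
Definition transverse_path (R : realType) (S : seed) (W : choiceType)
    (D : W -> wall R S) (g : R -> MR R S) : Prop :=
  [/\ forall (k : nat) (t : R), derivable (derive1n k g) t 1,
      forall t, 0 <= t <= 1 -> derive1 g t != 0,
      ~ Supp D (g 0) /\ ~ Supp D (g 1),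
      forall t, 0 <= t <= 1 -> ~ Sing D (g t) &
      forall t w, 0 <= t <= 1 -> wsupp (D w) (g t) ->
        pairR (wnormal (D w)) (derive1 g t) != 0].

(* s lists in order of time the crossings of g with the walls that are nontrivial
   mod J^k. The order among simultaneous crossings is free: away from Sing the
   walls through a point lie in one hyperplane and their actions commute. *)
Definition crossings (R : realType) (S : seed) (C : set (MR R S))
    (W : choiceType) (D : W -> wall R S) (g : R -> MR R S) (k : nat)
    (s : seq (R * W)) : Prop :=
  [/\ uniq s, sorted (fun x y : R * W => x.1 <= y.1) s &
      forall t w, (t, w) \in s <->
        [/\ 0 <= t <= 1, wsupp (D w) (g t) & ~ one_mod C k (D w)]].

Definition path_product (R : realType) (S : seed) (W : choiceType)
    (D : W -> wall R S) (g : R -> MR R S) (s : seq (R * W)) (a : fseries R S) :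
    fseries R S :=
  foldl (fun b x => wall_cross (D x.2) (derive1 g x.1) b) a s.

(* Path ordered products are compared mod J^k for every k. *)
Definition consistent (R : realType) (S : seed) (C : set (MR R S))
    (W : choiceType) (D : W -> wall R S) : Prop :=
  forall g1 g2, transverse_path D g1 -> transverse_path D g2 ->
  g1 0 = g2 0 -> g1 1 = g2 1 ->
  forall k s1 s2, crossings C D g1 k s1 -> crossings C D g2 k s2 ->
  forall m m', pmon C m -> ~ Jpow C k m' ->
    path_product D g1 s1 (monomial 1 m) m' =
    path_product D g2 s2 (monomial 1 m) m'.

Definition cluster_scattering_diagram (R : realType) (S : seed)
    (C : set (MR R S)) (W : choiceType) (D : W -> wall R S) : Prop :=
  [/\ scattering_diagram C D, consistent C D,
      exists init : 'I_(rk S) -> W,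
        [/\ {in uf S &, injective init},
            forall i, i \in uf S ->
              [/\ wsupp (D (init i)) = perp (basis_vec i),
                  wnormal (D (init i)) = basis_vec i &
                  wser (D (init i)) =1 ps1X R] &
            forall w, (forall i, i \in uf S -> w <> init i) ->
              ~ incoming (D w)] &
      forall w, exists2 c : nat, (0 < c)%N & wser (D w) =1 psexp (ps1X R) c].

(** * Broken lines *)

(* A piecewise linear path on (-oo, 0] with bends at t_1 <= ... <= t_s
   ([dr_times]), the monomials c_j z^(m_j) of the successive domains of linearity
   (s+1 of them, [dr_monos]), and for each bend one wall at which it takes place
   ([dr_walls]). Values of [dr_path] at positive times are irrelevant. *)
Record dray (R : realType) (S : seed) (W : choiceType) := Dray {
  dr_path : R -> MR R S;
  dr_times : seq R;
  dr_monos : seq (R[i] * lattice S);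
  dr_walls : seq W }.

Definition dr_coef (R : realType) (S : seed) (W : choiceType) (r : dray R S W)
    (j : nat) : R[i] := (nth (0, 0) (dr_monos r) j).1.
Definition dr_exp (R : realType) (S : seed) (W : choiceType) (r : dray R S W)
    (j : nat) : lattice S := (nth (0, 0) (dr_monos r) j).2.

(* The closure of the domain of linearity number j. The default value 0 of [nth]
   is the final time, the upper end of the last domain. *)
Definition in_domain (R : realType) (ts : seq R) (j : nat) (t : R) : Prop :=
  ((0 < j)%N -> nth 0 ts j.-1 <= t) /\ t <= nth 0 ts j.

Definition linear_ray (R : realType) (S : seed) (W : choiceType)
    (r : dray R S W) : Prop :=
  [/\ size (dr_monos r) = (size (dr_times r)).+1,
      size (dr_walls r) = size (dr_times r),
      sorted <=%R (dr_times r), all (fun t => t <= 0) (dr_times r) &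
      forall j t u, (j <= size (dr_times r))%N ->
        in_domain (dr_times r) j t -> in_domain (dr_times r) j u ->
        dr_path r t - dr_path r u = - (t - u) *: toR R (dr_exp r j)].

(* c' is the coefficient of z^m' in the image of c z^m under the crossing, with
   velocity -m, of all walls through x. It is computed mod z^m J^k for a k that
   sees m', where only the finitely many walls nontrivial mod J^k contribute. *)
Definition cross_coef (R : realType) (S : seed) (C : set (MR R S))
    (W : choiceType) (D : W -> wall R S) (x : MR R S) (c : R[i])
    (m : lattice S) (c' : R[i]) (m' : lattice S) : Prop :=
  exists k (s : seq W),
    [/\ ~ Jpow C k (m' - m), uniq s,
        forall w, w \in s <-> wsupp (D w) x /\ ~ one_mod C k (D w) &
        c' = foldr (fun w => wall_cross (D w) (- toR R m)) (monomial c m) s m'].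

Definition generic_broken_line (R : realType) (S : seed) (C : set (MR R S))
    (W : choiceType) (D : W -> wall R S) (r : dray R S W) : Prop :=
  [/\ linear_ray r,
      [/\ {within [set t : R | t <= 0], continuous (dr_path r)},
          forall K, compact K ->
            compact ([set t : R | t <= 0] `&` dr_path r @^-1` K),
          forall t, t <= 0 -> ~ Sing D (dr_path r t) & ~ Supp D (dr_path r 0)],
      sorted <%R (dr_times r) /\ all (fun t => t < 0) (dr_times r),
      dr_exp r 0 != 0 /\ dr_coef r 0 = 1 &
      forall j w0, (j < size (dr_times r))%N ->
        let x := dr_path r (nth 0 (dr_times r) j) in
        [/\ wsupp (D (nth w0 (dr_walls r) j)) x,
            dr_exp r j.+1 != dr_exp r j, dr_coef r j.+1 != 0 &
            cross_coef C D x (dr_coef r j) (dr_exp r j)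
                       (dr_coef r j.+1) (dr_exp r j.+1)]].

Record bline (R : realType) (S : seed) (W : choiceType) := Bline {
  bl_ray : dray R S W;
  bl_seq : nat -> dray R S W }.

(* A ray with a defining sequence. This covers non-generic broken lines, generic
   ones with the constant sequence, and also generic ones arising as a limit: one
   member of a based pair may be generic while the other one is not, and then its
   defining sequence cannot be constant. *)
Definition broken_line (R : realType) (S : seed) (C : set (MR R S))
    (W : choiceType) (D : W -> wall R S) (G : bline R S W) : Prop :=
  [/\ linear_ray (bl_ray G),
      forall k, generic_broken_line C D (bl_seq G k),
      forall k, [/\ size (dr_times (bl_seq G k)) = size (dr_times (bl_ray G)),
                    dr_monos (bl_seq G k) = dr_monos (bl_ray G) &
                    dr_walls (bl_seq G k) = dr_walls (bl_ray G)],
      forall t, t <= 0 ->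
        (fun k => dr_path (bl_seq G k) t) @ \oo --> dr_path (bl_ray G) t &
      forall j, (fun k => nth 0 (dr_times (bl_seq G k)) j) @ \oo -->
                nth 0 (dr_times (bl_ray G)) j].

Definition bl_end (R : realType) (S : seed) (W : choiceType)
    (G : bline R S W) : MR R S := dr_path (bl_ray G) 0.
Definition bl_init (R : realType) (S : seed) (W : choiceType)
    (G : bline R S W) : lattice S := dr_exp (bl_ray G) 0.
Definition bl_final (R : realType) (S : seed) (W : choiceType)
    (G : bline R S W) : lattice S :=
  dr_exp (bl_ray G) (size (dr_times (bl_ray G))).

Definition based (R : realType) (S : seed) (W : choiceType)
    (G1 G2 : bline R S W) : Prop :=
  forall k, dr_path (bl_seq G1 k) 0 = dr_path (bl_seq G2 k) 0.

Definition balanced (R : realType) (S : seed) (W : choiceType)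
    (G1 G2 : bline R S W) (x : MR R S) : Prop :=
  [/\ based G1 G2, bl_end G1 = x, bl_end G2 = x &
      toR R (bl_final G1) + toR R (bl_final G2) = x].

(** * Segments *)

Record segment (R : realType) (S : seed) (W : choiceType) := Segment {
  sg_len : R;
  sg_path : R -> MR R S;
  sg_times : seq R;
  sg_exps : seq (lattice S);
  sg_walls : seq W }.

(* The restriction of G to [t0, t0 + T]. The p bends before it and those after it
   are dropped. A bend at an end of the interval may be recorded or not. *)
Definition segment_of (R : realType) (S : seed) (W : choiceType)
    (sg : segment R S W) (G : bline R S W) : Prop :=
  let r := bl_ray G in
  let T := sg_len sg in
  let s := size (sg_times sg) in
  exists (t0 : R) (p : nat),
    [/\ [/\ 0 <= T, t0 + T <= 0 & (p + s <= size (dr_times r))%N],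
        forall t, 0 <= t <= T -> sg_path sg t = dr_path r (t0 + t),
        [/\ all (fun t => t <= t0) (take p (dr_times r)),
            all (fun t => t0 <= t <= t0 + T) (take s (drop p (dr_times r))) &
            all (fun t => t0 + T <= t) (drop (p + s) (dr_times r))],
        sg_times sg = [seq t - t0 | t <- take s (drop p (dr_times r))] &
        sg_exps sg = [seq x.2 | x <- take s.+1 (drop p (dr_monos r))] /\
        sg_walls sg = take s (drop p (dr_walls r))].

Definition broken_line_segment (R : realType) (S : seed) (C : set (MR R S))
    (W : choiceType) (D : W -> wall R S) (sg : segment R S W) : Prop :=
  exists2 G, broken_line C D G & segment_of sg G.

(* ns lists a primitive vector of N° orthogonal to the wall of each bend. *)
Definition bend_normals (R : realType) (S : seed) (W : choiceType)
    (D : W -> wall R S) (sg : segment R S W) (ns : seq (lattice S)) : Prop :=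
  size ns = size (sg_walls sg) /\
  forall j w0, (j < size ns)%N ->
    primitive (nth 0 ns j) /\
    wsupp (D (nth w0 (sg_walls sg) j)) `<=` perp (nth 0 ns j).

Definition bends_before (R : realType) (S : seed) (W : choiceType)
    (sg : segment R S W) (tau : R) : nat :=
  count (fun t => t < tau) (sg_times sg).

(* Bends are numbered from 0 in the lists: with l bends before tau, the j-th bend
   on side (1) is number l - j and the j-th on side (2) is number l + j - 1. *)
Definition rho1 (R : realType) (S : seed) (W : choiceType)
    (sg : segment R S W) (ns : seq (lattice S)) (tau : R) : int :=
  let l := bends_before sg tau in
  \prod_(1 <= j < l.+1) pairZ (nth 0 ns (l - j)%N) (nth 0 (sg_exps sg) (l - j)%N).

Definition rho2 (R : realType) (S : seed) (W : choiceType)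
    (sg : segment R S W) (ns : seq (lattice S)) (tau : R) : int :=
  let l := bends_before sg tau in
  \prod_(1 <= j < (size (sg_times sg) - l).+1)
    pairZ (nth 0 ns (l + j).-1) (nth 0 (sg_exps sg) (l + j)%N).

Definition in_multiple (R : realType) (S : seed) (rho : int) (x : MR R S) :
    Prop :=
  exists u : lattice S, x = toR R (rho *: u).

(* Main.v *)
Require Import Defs.
From HB Require Import structures.
From mathcomp Require Import all_boot all_order all_algebra.
From mathcomp Require Import all_classical all_reals all_analysis.
From mathcomp.real_closed Require Import complex.
From mathcomp Require Import ring lra zify.

(** The two rays of the pair are images of the two halves of the segment under
    projective maps. Let y be the segment, of length T, and write h = a + b. On a
    domain of linearity with exponent m the vector y(t) + t m is constant. Hence
    the curve h tau y(t) / t, for 0 < t <= tau, is piecewise linear, with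
    direction y(t) + t m on that domain; it comes from infinity in the direction
    of y(0) and ends at h y(tau). Parametrized with velocity -f, where
    f = a (y(t) + t m), it has initial exponent a y(0). Its bends lie on the rays
    through the bends of the segment, and since walls are cones, they lie on the
    same walls. At a bend at time t, both the exponent of the wall function and
    the change of f are a t times those of the segment. As wall functions are
    powers of binomials 1 + z^(p1 n), multiplying all data of a bend by a positive
    integer gives an allowed bend (cross_walls_supp, cross_walls_gt0,
    bends_by_scale). The other half is treated in the same way, with T - t
    instead of t and -m instead of m. The final exponents are a (x + tau m) and
    b (x - (T - tau) m) for x = y(tau); they add up to h x because
    a tau = b (T - tau).

    That the numbers a t are integers and the f are lattice points follows from
    the divisibility hypotheses (side_of_half): pairing a (y + t m) with the
    normal of the next bend, which annihilates y, computes the next a t, and each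
    such step uses up one factor of rho. Bends at the very ends of the segment
    have a t = 0 or b (T - t) = 0 and disappear.

    It remains to approximate both rays by generic broken lines with a common
    endpoint. A path with prescribed exponents and prescribed hyperplanes for its
    bends is determined by its endpoint Q, and all its bends depend linearly on Q
    (line, bend, line_mx). The segment is a limit of generic segments. One of them
    suffices: moving the endpoint from h x by ka times its displacement moves the
    bends to positive combinations of multiples of the limit bends and of the
    generic bends, for all small ka > 0 (deformed_line, deformed_time). The limit
    bend is a limit of points of the walls in question and the generic bend is
    interior to them, so the combinations are interior as well (relint_comb), and
    an open set of endpoints is allowed (deformed_orderly). Singular points lie in
    countably many subspaces of codimension two (sing_sub), so that generic
    endpoints in this open set give paths without singular points
    (avoids_dense). Finally, only finitely many walls influence the coefficient of
    a given term, because the powers of the ideal J separate exponents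
    (Jpow_separated); a suitable sequence of endpoints meets the same ones of
    these walls throughout, and then all its broken lines carry the same monomials
    (pair_of_broken_lines). *)

Set Implicit Arguments.
Unset Strict Implicit.
Unset Printing Implicit Defensive.
Import Order.TTheory GRing.Theory Num.Theory.
Import numFieldNormedType.Exports.
Local Open Scope classical_set_scope.
Local Open Scope ring_scope.

(** * The lattice pairing *)

Section Pairing.
Variables (R : realType) (S : seed).
Implicit Types (v w : lattice S) (x y : MR R S).

Definition ncol v : 'cV[R]_(rk S) := \col_i ((v 0 i)%:~R / (mult i)%:R).

Lemma pairRE v x : pairR v x = (x *m ncol v) 0 0.
Proof. by rewrite mxE; apply: eq_bigr => i _; rewrite mxE mulrC. Qed.

Lemma pairRD v x y : pairR v (x + y) = pairR v x + pairR v y.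
Proof. by rewrite !pairRE mulmxDl mxE. Qed.

Lemma pairRZ v k x : pairR v (k *: x) = k * pairR v x.
Proof. by rewrite !pairRE -scalemxAl mxE. Qed.

Lemma pairRN v x : pairR v (- x) = - pairR v x.
Proof. by rewrite -scaleN1r pairRZ mulN1r. Qed.

Lemma pairRB v x y : pairR v (x - y) = pairR v x - pairR v y.
Proof. by rewrite pairRD pairRN. Qed.

Lemma pairR_0 v : pairR v (0 : MR R S) = 0.
Proof. by rewrite -(scale0r (0 : MR R S)) pairRZ mul0r. Qed.

Lemma pairR_sum v (I : Type) (r : seq I) (P : pred I) (F : I -> MR R S) :
  pairR v (\sum_(i <- r | P i) F i) = \sum_(i <- r | P i) pairR v (F i).
Proof.
by apply: (big_morph (pairR v)); [exact: pairRD | exact: pairR_0].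
Qed.

Lemma ncol_eq0 v : ncol v = 0 -> v = 0.
Proof.
move/colP => v0; apply/rowP => i; have := v0 i; rewrite !mxE => /eqP.
rewrite mulf_eq0 invr_eq0 pnatr_eq0 -leqn0 leqNgt mult_gt0 orbF intr_eq0.
by move/eqP.
Qed.

Lemma toRD v w : toR R (v + w) = toR R v + toR R w.
Proof. exact: map_mxD. Qed.

Lemma toRB v w : toR R (v - w) = toR R v - toR R w.
Proof. exact: map_mxB. Qed.

Lemma toRN v : toR R (- v) = - toR R v.
Proof. exact: map_mxN. Qed.

Lemma toRZ (k : int) v : toR R (k *: v) = k%:~R *: toR R v.
Proof. by rewrite /toR map_mxZ. Qed.

Lemma toR0 : toR R (0 : lattice S) = 0.
Proof. exact: map_mx0. Qed.

Lemma toRMn v k : toR R (v *+ k) = k%:R *: toR R v.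
Proof.
elim: k => [|k IHk]; first by rewrite mulr0n toR0 scale0r.
by rewrite mulrSr toRD IHk -natr1 scalerDl scale1r.
Qed.

Lemma toR_sum (I : Type) (r : seq I) (P : pred I) (F : I -> lattice S) :
  toR R (\sum_(i <- r | P i) F i) = \sum_(i <- r | P i) toR R (F i).
Proof. by apply: (big_morph (@toR R S)); [exact: toRD | exact: toR0]. Qed.

Lemma toR_inj : injective (@toR R S).
Proof.
move=> v w /rowP e; apply/rowP => i; have := e i; rewrite !mxE.
exact: intr_inj.
Qed.

Lemma pairR_toR v m : Ncirc v -> pairR v (toR R m) = (pairZ v m)%:~R.
Proof.
move=> vN; rewrite /pairR /pairZ rmorph_sum /=; apply: eq_bigr => i _.
rewrite mxE rmorphM /=; congr (_ * _).
have d0 : (mult i)%:R != 0 :> R by rewrite pnatr_eq0 -lt0n mult_gt0.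
apply: (mulIf d0); rewrite divfK //.
have -> : (mult i)%:R = ((mult i)%:Z)%:~R :> R by [].
by rewrite -rmorphM /= divzK //; exact: vN.
Qed.

Lemma pairZB v m m' : pairZ v (m - m') = pairZ v m - pairZ v m'.
Proof.
rewrite /pairZ -sumrB; apply: eq_bigr => i _; by rewrite !mxE mulrDr mulrN.
Qed.

Lemma pairR_p1 v n : Nuf_of (uf S) v ->
  pairR n (toR R (p1 v)) = ratr (form_of (Defs.skew S) v n).
Proof.
move=> uv; rewrite /form_of exchange_big /= (rmorph_sum (@ratr R)) /=; apply: eq_bigr => i _.
have d0 : (mult i)%:R != 0 :> R by rewrite pnatr_eq0 -lt0n mult_gt0.
have -> : toR R (p1 v) 0 i =
    ratr (\sum_a (v 0 a)%:~R * Defs.skew S a i) * (mult i)%:R.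
  rewrite !mxE -[(numq _)%:~R]ratr_int numqK; last first.
    apply: form_uf_circ => // j; rewrite mulmxnE !mxE eqxx /=.
    case: eqP => [-> | _]; last by rewrite mul0rn dvdz0.
    have <- : (mult i)%:R = (mult i)%:Z by exact: natz.
    exact: (dvdzz (mult i)%:R).
  rewrite -(ratr_nat R) -(rmorphM (@ratr R)) /= mulr_suml; congr ratr.
  apply: eq_bigr => a _; rewrite (bigD1 i) //= big1 ?addr0 => [|j ji].
    by rewrite mulmxnE !mxE !eqxx rmorphMn.
  by rewrite mulmxnE !mxE eqxx (negbTE ji) mul0rn mulr0.
rewrite [ratr _ * _]mulrC mulrA divfK // -(ratr_int R) -(rmorphM (@ratr R)) /=.
by congr ratr; rewrite mulrC mulr_suml.
Qed.

Lemma form_skew_self (v : lattice S) : form_of (Defs.skew S) v v = 0.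
Proof.
have e : form_of (Defs.skew S) v v = - form_of (Defs.skew S) v v.
  rewrite {1}/form_of exchange_big /= -sumrN; apply: eq_bigr => i _.
  rewrite -sumrN; apply: eq_bigr => j _.
  have /matrixP/(_ i j) := Defs.skewP S; rewrite !mxE => ->; ring.
lra.
Qed.

(** Proportionality is stated for linear forms rather than for lattice vectors,
    since it is only applied to points and exponents. *)
Definition parallel v w : Prop :=
  exists2 r : R, r != 0 & forall x, pairR v x = r * pairR w x.

Lemma parallel_sym v w : parallel v w -> parallel w v.
Proof.
by case=> r r0 e; exists r^-1; rewrite ?invr_eq0 // => x; rewrite e mulKf.
Qed.

Lemma parallel_trans u v w : parallel u v -> parallel v w -> parallel u w.
Proof.
move=> [r r0 e] [q q0 e']; exists (r * q); first by rewrite mulf_neq0.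
by move=> x; rewrite e e' mulrA.
Qed.

Lemma parallel_eq0 v w x : parallel v w -> (pairR v x == 0) = (pairR w x == 0).
Proof. by case=> r r0 e; rewrite e mulf_eq0 (negbTE r0). Qed.

(** Skew-symmetry: crossing a wall changes an exponent along the wall. *)
Lemma parallel_p1 v w : parallel v w -> Nuf_of (uf S) w ->
  pairR v (toR R (p1 w)) = 0.
Proof.
move=> vw uw; apply/eqP; rewrite (parallel_eq0 _ vw) pairR_p1 //.
by rewrite form_skew_self rmorph0.
Qed.

Lemma Nplus_neq0 v : Nplus v -> v != 0.
Proof.
case=> _ _; apply: contraTneq => ->; rewrite big1 ?ltxx // => i _.
by rewrite mxE.
Qed.

Lemma primitive_neq0 v : primitive v -> v != 0.
Proof.
case=> _ pv; apply/eqP => v0.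
have := pv 2 v; rewrite v0 scaler0 => /(_ _ erefl) H.
by have : `|2 : int| = 1 by apply: H => i; rewrite mxE dvdz0.
Qed.

(** The rank is at most one when both forms vanish on a subspace of codimension
    one, which is how normals of walls are compared. *)
Lemma rank1_parallel v w : v != 0 -> w != 0 ->
  (\rank (row_mx (ncol v) (ncol w)) <= 1)%N -> parallel w v.
Proof.
move=> v0 w0 rk1.
have v0' : ncol v != 0 by apply: contra_neq v0 => /ncol_eq0.
have w0' : ncol w != 0 by apply: contra_neq w0 => /ncol_eq0.
have e : (row_mx (ncol v) (ncol w))^T = col_mx (ncol v)^T (ncol w)^T.
  exact: tr_row_mx.
have rv : \rank (ncol v)^T = 1%N.
  by apply/eqP; rewrite eqn_leq rank_leq_row lt0n mxrank_eq0 trmx_eq0.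
have sub : ((ncol v)^T <= col_mx (ncol v)^T (ncol w)^T)%MS.
  by rewrite -addsmxE addsmxSl.
have : (col_mx (ncol v)^T (ncol w)^T <= (ncol v)^T)%MS.
  by rewrite -(mxrank_leqif_sup sub) eqn_leq mxrankS // rv -e mxrank_tr.
rewrite col_mx_sub submx_refl /= => /sub_rVP [r er].
have ew : ncol w = r *: ncol v by apply: trmx_inj; rewrite er linearZ.
exists r; last by move=> x; rewrite !pairRE ew -scalemxAr mxE.
by apply: contra_neq w0' => r0; rewrite ew r0 scale0r.
Qed.

Lemma ray_gen_Ncirc v : Ncirc (ray_gen R v).
Proof.
rewrite /ray_gen; case: xgetP => [g _ /= e|_ i]; last by rewrite mxE dvdz0.
have : [set g *+ k | k in [set: nat]] g by exists 1%N.
by rewrite -e; case.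
Qed.

Lemma ray_gen_prop v : exists2 r : R, 0 <= r &
  forall x, pairR (ray_gen R v) x = r * pairR v x.
Proof.
suff [r r0 e] : exists2 r : R, 0 <= r & toR R (ray_gen R v) = r *: toR R v.
  exists r => // x; rewrite /pairR mulr_sumr; apply: eq_bigr => i _.
  by have /rowP/(_ i) := e; rewrite !mxE => ->; rewrite !mulrA.
rewrite /ray_gen; case: xgetP => [g _ /= e|_].
  have : [set g *+ k | k in [set: nat]] g by exists 1%N.
  by rewrite -e; case.
(* The default value of the generator is a multiple as well. *)
by exists 0; rewrite // scale0r toR0.
Qed.

End Pairing.

(** * The terms of a wall crossing *)

Section Crossing.
Variables (R : realType) (S : seed).

(** The shape of the wall functions of a cluster scattering diagram and of their
    natural powers: stable under products, and free of cancellation. *)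
Definition pos_upto (f : nat -> R[i]) (N : nat) : Prop :=
  (forall k, (k <= N)%N -> 0 < f k) /\ (forall k, (N < k)%N -> f k = 0).

Lemma pos_upto_ge0 f N k : pos_upto f N -> 0 <= f k.
Proof.
by move=> [fpos f0]; have [/fpos/ltW|/f0->] := leqP k N.
Qed.

Lemma psmul_pos f g N M :
  pos_upto f N -> pos_upto g M -> pos_upto (psmul f g) (N + M).
Proof.
move=> fN gM; have [[fpos f0] [gpos g0]] := (fN, gM).
split=> k kNM; rewrite /psmul.
  have jk : (minn k N < k.+1)%N by rewrite ltnS geq_minl.
  rewrite (bigD1 (Ordinal jk)) //=; apply: ltr_pwDl.
    by apply: mulr_gt0; [apply: fpos; rewrite geq_minr | apply: gpos; lia].
  by apply: sumr_ge0 => j _; apply: mulr_ge0; apply: pos_upto_ge0; eassumption.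
apply: big1 => j _; have [jN|jN] := leqP j N; last by rewrite f0 ?mul0r.
by rewrite g0 ?mulr0 //; lia.
Qed.

Lemma psexp_pos f N e : pos_upto f N -> pos_upto (psexp f e) (e * N).
Proof.
move=> fN; elim: e => [|e IHe] /=; last by rewrite mulSn; exact: psmul_pos.
by rewrite mul0n; split=> -[|k] //= _; rewrite /psone /= ltr01.
Qed.

Lemma psexp_ps1X_pos c : pos_upto (psexp (ps1X R) c) c.
Proof.
rewrite -{2}[c]muln1; apply: psexp_pos; by split=> -[|[|k]] //= _; rewrite /ps1X /= ltr01.
Qed.

Lemma eq_pos_upto f g N : f =1 g -> pos_upto g N -> pos_upto f N.
Proof. by move=> fg [gp g0]; split=> k kN; rewrite fg; [exact: gp|exact: g0]. Qed.

(** The exponent of the wall function in the crossing of a monomial. *)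
Definition cross_exp (w : wall R S) (m : lattice S) : nat :=
  `|pairZ (ray_gen R (wnormal w)) m|%N.

(** Along the wall the exponent is constant and its sign is compensated by that
    of the velocity, so only finitely many terms occur. *)
Lemma wall_crossE (w : wall R S) c m0 (a : fseries R S) m' :
    pos_upto (wser w) c ->
    (forall m, a m != 0 ->
       pairR (wnormal w) (toR R m) = pairR (wnormal w) (toR R m0)) ->
  wall_cross w (- toR R m0) a m' =
  \sum_(j < (cross_exp w m0 * c).+1)
     a (m' - p1 (wnormal w) *+ j) * psexp (wser w) (cross_exp w m0) j.
Proof.
move=> wc am0; rewrite /wall_cross.
set n := wnormal w; set n0 := ray_gen R n; set E := cross_exp w m0.
have [r r0 n0E] := @ray_gen_prop R S n.
have n0N := @ray_gen_Ncirc R S n.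
have expE m : a m != 0 -> (- sgz (pairR n (- toR R m0))) * pairZ n0 m = E.
  move=> /am0 nm; rewrite pairRN sgzN opprK.
  have -> : pairZ n0 m = pairZ n0 m0.
    by apply: (@intr_inj R); rewrite -!pairR_toR // !n0E nm.
  rewrite /E /cross_exp -/n -/n0.
  have e : (pairZ n0 m0)%:~R = r * pairR n (toR R m0) :> R.
    by rewrite -pairR_toR // n0E.
  case: (sgzP (pairR n (toR R m0))) => n_sgn.
  - have -> : pairZ n0 m0 = 0 by apply: (@intr_inj R); rewrite e n_sgn mulr0.
    by rewrite absz0.
  - have : 0 <= pairZ n0 m0 by rewrite -(ler0z R) e mulr_ge0 // ltW.
    by rewrite mul1r => /gez0_abs.
  - have : pairZ n0 m0 <= 0 by rewrite -(lerz0 R) e mulr_ge0_le0 // ltW.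
    by rewrite mulN1r => /lez0_abs.
pose F (j : nat) := a (m' - p1 n *+ j) * psexp (wser w) E j.
rewrite (@eq_fsbigr _ _ _ _ _ F); last first.
  move=> j _; rewrite /F /=; case: (eqVneq (a (m' - p1 n *+ j)) 0) => [->|am].
    by rewrite !mul0r.
  by rewrite expE.
rewrite (@fsbig_ord _ _ _ (E * c).+1 F); apply/esym.
apply: fsbig_widen => // j [_] /= /negP; rewrite -leqNgt => jE.
by rewrite /F (psexp_pos E wc).2 ?mulr0.
Qed.

Variables (W : choiceType) (D : W -> wall R S) (c : W -> nat).
Hypothesis wserD : forall w, pos_upto (wser (D w)) (c w).

(** How m' arises from m in the crossing of the walls of s: u w is the degree of
    the term picked from the relevant power of the wall function of w. *)
Definition reaches (s : seq W) (m m' : lattice S) (u : W -> nat) : Prop :=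
  (forall w, w \in s -> (u w <= cross_exp (D w) m * c w)%N) /\
  m' = m + \sum_(w <- s) p1 (wnormal (D w)) *+ u w.

(** For the walls through a nonsingular point, by skew-symmetry. *)
Definition along (s : seq W) : Prop :=
  forall w w', w \in s -> w' \in s ->
    pairR (wnormal (D w)) (toR R (p1 (wnormal (D w')))) = 0.

Definition cross_walls s m co : fseries R S :=
  foldr (fun w => wall_cross (D w) (- toR R m)) (monomial co m) s.

Lemma along_reaches w s m m' u : along (w :: s) -> reaches s m m' u ->
  pairR (wnormal (D w)) (toR R m') = pairR (wnormal (D w)) (toR R m).
Proof.
move=> als [_ ->]; rewrite toRD pairRD toR_sum pairR_sum big_seq.
rewrite big1 ?addr0 // => w' w's; rewrite toRMn pairRZ als ?mulr0 //.
  by rewrite mem_head.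
by rewrite inE w's orbT.
Qed.

Lemma along_cons w s : along (w :: s) -> along s.
Proof. by move=> als w1 w2 ? ?; apply: als; rewrite inE; apply/orP; right. Qed.

Lemma cross_walls_supp s m co m' : uniq s -> along s ->
  cross_walls s m co m' != 0 -> exists u, reaches s m m' u.
Proof.
elim: s m' => [|w s IHs] m' /=.
  move=> _ _; rewrite /cross_walls /= /monomial; case: (eqVneq m' m) => [->|_]; last first.
    by rewrite eqxx.
  by move=> _; exists (fun=> 0%N); split=> //; rewrite big_nil addr0.
move=> /andP[ws us] als; rewrite /cross_walls /= -/(cross_walls s m co).
have als' := along_cons als.
rewrite (wall_crossE (c := c w)) //; last first.
  move=> m1 /(IHs _ us als')[u]; exact: along_reaches.
move=> /eqP H; have [j] : exists j : 'I_(cross_exp (D w) m * c w).+1,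
    cross_walls s m co (m' - p1 (wnormal (D w)) *+ j) != 0.
  apply: contrapT => /forallNP nj; apply: H; apply: big1 => j _.
  by have /negP := nj j; rewrite negbK => /eqP ->; rewrite mul0r.
move=> /(IHs _ us als')[u [ub em]].
exists (fun x => if x == w then j : nat else u x); split.
  move=> x; rewrite inE; case: eqP => [-> _|_ /= xs]; last exact: ub.
  by rewrite -ltnS.
rewrite big_cons eqxx.
have -> : \sum_(x <- s) p1 (wnormal (D x)) *+ (if x == w then j : nat else u x) =
          \sum_(x <- s) p1 (wnormal (D x)) *+ u x.
  rewrite big_seq [RHS]big_seq; apply: eq_bigr => x xs.
  by case: (eqVneq x w) xs => // ->; rewrite (negbTE ws).
by rewrite addrCA -em addrC subrK.
Qed.

Lemma cross_walls_ge0 s m co m' : uniq s -> along s -> 0 <= co ->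
  0 <= cross_walls s m co m'.
Proof.
move=> us als co0; elim: s us als m' => [|w s IHs] /=.
  by move=> _ _ m'; rewrite /cross_walls /= /monomial; case: ifP.
move=> /andP[ws us] als m'; rewrite /cross_walls /= -/(cross_walls s m co).
have als' := along_cons als.
rewrite (wall_crossE (c := c w)) //; last first.
  by move=> m1 /(cross_walls_supp us als')[u]; exact: along_reaches.
apply: sumr_ge0 => j _; apply: mulr_ge0; first exact: IHs.
by apply: pos_upto_ge0; apply: psexp_pos; exact: wserD.
Qed.

(** All contributions are nonnegative, so none of them is cancelled. *)
Lemma cross_walls_gt0 s m co m' u : uniq s -> along s -> 0 < co ->
  reaches s m m' u -> 0 < cross_walls s m co m'.
Proof.
move=> us als co0; elim: s us als m' => [|w s IHs] /=.
  move=> _ _ m' [_]; rewrite big_nil addr0 => ->.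
  by rewrite /cross_walls /= /monomial eqxx.
move=> /andP[ws us] als m' [ub em]; rewrite /cross_walls /= -/(cross_walls s m co).
have als' := along_cons als.
rewrite (wall_crossE (c := c w)) //; last first.
  by move=> m1 /(cross_walls_supp us als')[u']; exact: along_reaches.
have uw : (u w < (cross_exp (D w) m * c w).+1)%N.
  by rewrite ltnS; apply: ub; rewrite mem_head.
rewrite (bigD1 (Ordinal uw)) //=; apply: ltr_pwDl.
  apply: mulr_gt0; last by apply: (psexp_pos _ (wserD w)).1.
  apply: IHs => //; split=> [x xs|]; first by apply: ub; rewrite inE xs orbT.
  by rewrite em big_cons [p1 _ *+ _ + _]addrC addrA addrK.
apply: sumr_ge0 => j _; apply: mulr_ge0; first exact: cross_walls_ge0 (ltW _).
by apply: pos_upto_ge0; apply: psexp_pos; exact: wserD.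
Qed.

End Crossing.

(** * Cones and the adic filtration *)

Section RowNorm.
Variable R : realType.

Lemma coord_le_norm n (x : 'rV[R]_n) i : `|x 0 i| <= `|x|.
Proof.
rewrite [leRHS]/Num.norm /= mx_normrE.
exact: (@le_bigmax _ _ _ 0 (fun ij => `|x ij.1 ij.2|) (0, i)).
Qed.

Lemma nbhs_rVP n (x : 'rV[R]_n) (P : set 'rV[R]_n) :
  nbhs x P <-> exists2 e : R, 0 < e & forall y, `|y - x| < e -> P y.
Proof.
split=> [/(@nbhs_normP R 'rV[R]_n x P).1 [e /= e0 eP]|[e e0 eP]].
  by exists e => // y yx; apply: eP; rewrite /= distrC.
apply: (@nbhs_normP R 'rV[R]_n x P).2; exists e => //= y xy.
by apply: eP; rewrite distrC.
Qed.

Lemma mulmx_bound m n (M : 'M[R]_(m, n)) :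
  exists2 K : R, 0 < K & forall x : 'rV[R]_m, `|x *m M| <= K * `|x|.
Proof.
exists (1 + \sum_i `|row i M|).
  by apply: ltr_pwDl => //; apply: sumr_ge0.
move=> x; rewrite mulmx_sum_row (le_trans (ler_norm_sum _ _ _)) //.
rewrite mulrDl mul1r ler_wpDl // mulr_suml ler_sum // => i _.
by rewrite normrZ mulrC ler_wpM2l // coord_le_norm.
Qed.

Lemma mulmx_continuous m n (M : 'M[R]_(m, n)) :
  continuous (fun x : 'rV[R]_m => x *m M).
Proof.
have [K K0 KM] := mulmx_bound M.
move=> x; have FF : Filter (nbhs x) by exact: nbhs_filter.
apply/cvgrPdist_lt => e e0; apply/nbhs_rVP.
exists (e / K); first by rewrite /= divr_gt0.
move=> y /= xy; rewrite distrC -mulmxBl (le_lt_trans (KM _)) //.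
by rewrite mulrC -ltr_pdivlMr.
Qed.

End RowNorm.

Section Cones.
Variables (R : realType) (S : seed).

Lemma rational_cone0 (A : set (MR R S)) : rational_cone A -> A 0.
Proof.
case=> k [G ->]; exists 0; last by rewrite mul0mx.
by move=> j; rewrite mxE.
Qed.

Lemma rational_coneD (A : set (MR R S)) x y :
  rational_cone A -> A x -> A y -> A (x + y).
Proof.
case=> k [G ->] [c c0 ->] [c' c'0 ->]; exists (c + c'); last by rewrite mulmxDl.
by move=> j; rewrite mxE addr_ge0.
Qed.

Lemma rational_coneZ (A : set (MR R S)) (r : R) x :
  rational_cone A -> 0 <= r -> A x -> A (r *: x).
Proof.
case=> k [G ->] r0 [c c0 ->]; exists (r *: c); last by rewrite scalemxAl.
by move=> j; rewrite mxE mulr_ge0.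
Qed.

Variables (C : set (MR R S)) (HC : monoid_cone C).

Let Ccone : rational_cone C. Proof. by case: HC. Qed.

Lemma pmon_D u v : pmon C u -> pmon C v -> pmon C (u + v).
Proof. by rewrite /pmon toRD; exact: rational_coneD. Qed.

Lemma pmon_Mn u k : pmon C u -> pmon C (u *+ k).
Proof. by rewrite /pmon toRMn; exact: rational_coneZ. Qed.

Lemma pmon_sum (I : eqType) (r : seq I) (F : I -> lattice S) :
  (forall i, i \in r -> pmon C (F i)) -> pmon C (\sum_(i <- r) F i).
Proof.
move=> CF; rewrite big_seq; apply: big_ind => //; last exact: pmon_D.
by rewrite /pmon toR0; exact: rational_cone0.
Qed.

Lemma Jpow_D k u v : Jpow C k u -> pmon C v -> Jpow C k (u + v).
Proof.
elim: k u => [|k IHk] u /=; first exact: pmon_D.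
move=> [u1 [u2 [Pu1 u10 Ju2 ->]]] Pv; exists u1, (u2 + v).
by split=> //; [exact: IHk | rewrite addrA].
Qed.

Lemma p1_pmon v : Nplus v -> pmon C (p1 v).
Proof.
case=> uv v0 _; rewrite /pmon.
suff -> : toR R (p1 v) =
    \sum_(i in uf S) (v 0 i)%:~R *: toR R (p1 (basis_vec i)).
  apply: big_ind; [exact: rational_cone0 | |].
    by move=> x y; exact: rational_coneD.
  move=> i iuf; apply: rational_coneZ => //; first by rewrite ler0z.
  by case: HC => _ _ _; exact.
have ub i : i \in uf S -> Nuf_of (uf S) (basis_vec i).
  by move=> iuf j; rewrite mxE eqxx; case: eqP => // ->; rewrite iuf.
suff H n : pairR n (toR R (p1 v)) = pairR n
    (\sum_(i in uf S) (v 0 i)%:~R *: toR R (p1 (basis_vec i))).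
  apply/rowP => j; have := H (basis_vec j *+ mult j).
  have E x : pairR (basis_vec j *+ mult j) x = x 0 j :> R.
    rewrite /pairR (bigD1 j) //= big1 => [|i ij].
      have d0 : (mult j)%:R != 0 :> R by rewrite pnatr_eq0 -lt0n mult_gt0.
      by rewrite addr0 mulmxnE !mxE !eqxx rmorphMn /= divff ?mul1r.
    by rewrite mulmxnE !mxE eqxx (negbTE ij) rmorphMn /= mul0rn !mul0r.
  by rewrite !E.
rewrite pairR_p1 // pairR_sum.
have -> : form_of (Defs.skew S) v n =
    \sum_(i in uf S) (v 0 i)%:~R * form_of (Defs.skew S) (basis_vec i) n.
  rewrite {1}/form_of (bigID (mem (uf S))) /= [X in _ + X]big1 ?addr0.
    apply: eq_bigr => i iuf; rewrite /form_of [in RHS](bigD1 i) //= [X in _ + X]big1.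
      rewrite addr0 mulr_sumr; apply: eq_bigr => j _.
      by rewrite mxE !eqxx mul1r mulrA.
    move=> k ki; apply: big1 => j _.
    by rewrite mxE eqxx (negbTE ki) !mul0r.
  by move=> i iuf; apply: big1 => j _; rewrite uv // !mul0r.
rewrite (rmorph_sum (@ratr R)) /=; apply: eq_bigr => i iuf.
by rewrite pairRZ pairR_p1 ?(rmorphM (@ratr R)) /= ?ratr_int //; exact: ub.
Qed.

Lemma norm_lattice_ge1 (u : lattice S) : u != 0 -> 1 <= `|toR R u|.
Proof.
move=> u0; have [i ui] : exists i, u 0 i != 0.
  by apply/existsP; apply: contra_neqT u0 => /existsPn H; apply/rowP => i;
    have := H i; rewrite mxE negbK => /eqP.
apply: le_trans (coord_le_norm _ i); rewrite mxE -intr_norm.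
by rewrite (ler_int _ 1) -gtz0_ge1 normr_gt0.
Qed.

(** Strict convexity bounds the coefficients of a point of the cone: by
    compactness the nonzero generators stay away from cancelling. *)
Lemma strict_cone_bound k (G : 'M[int]_(k, rk S)) :
    C = [set x | exists2 c : 'rV[R]_k,
           forall j, 0 <= c 0 j & x = c *m map_mx intr G] ->
  exists2 mu : R, 0 < mu & forall c : 'rV[R]_k, (forall j, 0 <= c 0 j) ->
    (forall j, row j G = 0 -> c 0 j = 0) ->
    forall i, mu * c 0 i <= `|c *m map_mx intr G|.
Proof.
move=> CG; pose g := map_mx intr G : 'M[R]_(k, rk S).
pose A i j : set R :=
  if j == i then [set 1] else `[0, (row j G != 0)%:R]%classic.
have mu_i i : exists2 mu : R, 0 < mu & row i G != 0 ->
    forall c : 'rV[R]_k, (forall j, A i j (c 0 j)) -> mu <= `|c *m g|.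
  have [Gi0|Gi0] := eqVneq (row i G) 0; first by exists 1.
  have cA : compact [set c : 'rV[R]_k | forall j, A i j (c 0 j)].
    apply: (@rV_compact _ _ (A i)) => j; rewrite /A; case: ifP => _.
      exact: compact_set1.
    exact: segment_compact.
  have A0 : [set c : 'rV[R]_k | forall j, A i j (c 0 j)] !=set0.
    exists (\row_j (j == i)%:R) => j; rewrite mxE /A.
    by case: ifP => _ //=; rewrite in_itv /= lexx ler0n.
  have [|c /set_mem /= cAi cmin] :=
      @EVT_min_rV R k (fun c => `|c *m g|) _ A0 cA.
    apply: continuous_subspaceT => c.
    apply: (@continuous_comp _ _ _ (fun c : 'rV[R]_k => c *m g) (fun x => `|x|)).
      exact: mulmx_continuous.
    exact: norm_continuous.
  exists `|c *m g|; last by move=> _ c' Ac'; apply: cmin; apply/mem_set.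
  rewrite normr_gt0; apply: contra_neq Gi0 => cg0.
  have c_ge0 j : 0 <= c 0 j.
    have := cAi j; rewrite /A; case: eqP => _ /=; first by move=> ->.
    by rewrite in_itv /= => /andP[].
  have ci : c 0 i = 1 by have := cAi i; rewrite /A eqxx.
  have Cgi : C (row i g).
    rewrite CG; exists (delta_mx 0 i); last by rewrite -rowE.
    by move=> j; rewrite mxE; case: (_ && _).
  have CNgi : C (- row i g).
    rewrite CG; exists (c - delta_mx 0 i).
      move=> j; rewrite !mxE eqxx /=; case: eqP => [->|_]; last by rewrite subr0.
      by rewrite ci subrr.
    by rewrite mulmxBl cg0 sub0r -rowE.
  case: HC => _ _ /(_ _ Cgi CNgi) gi0 _; apply/rowP => j.
  have /rowP/(_ j) := gi0; rewrite !mxE => /eqP; rewrite intr_eq0 => /eqP.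
  by [].
have /choice[mu muP] : forall i, exists mu : R, 0 < mu /\ (row i G != 0 ->
    forall c : 'rV[R]_k, (forall j, A i j (c 0 j)) -> mu <= `|c *m g|).
  by move=> i; have [mu] := mu_i i; exists mu.
pose m := \big[Num.min/1]_i mu i.
have m0 : 0 < m.
  by apply: lt_bigmin => // i _; case: (muP i).
have mle i : m <= mu i by apply: bigmin_le.
exists m => // c c0 cz i.
have [i0 _ imax] := @Order.TotalTheory.arg_maxP _ _ _ i predT (fun j => c 0 j) isT.
apply: (@le_trans _ _ (m * c 0 i0)); first by
  apply: ler_wpM2l; [exact: ltW | exact: (imax i isT)].
have [->|ci0] := eqVneq (c 0 i0) 0; first by rewrite mulr0.
have ci0' : 0 < c 0 i0 by rewrite lt0r ci0 c0.
have Gi0 : row i0 G != 0 by apply: contra_neq ci0 => /cz.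
apply: (@le_trans _ _ (mu i0 * c 0 i0)); first by apply: ler_wpM2r.
have [_ /(_ Gi0 ((c 0 i0)^-1 *: c))] := muP i0.
rewrite -scalemxAl normrZ gtr0_norm ?invr_gt0 // mulrC ler_pdivlMr //.
apply=> j; rewrite /A mxE; case: eqP => [->|_] /=.
  by rewrite mulVf.
rewrite in_itv /= mulr_ge0 ?invr_ge0 //=.
have [/cz ->|_] := eqVneq (row j G) 0; first by rewrite mulr0.
by rewrite /= mulrC ler_pdivrMr // mul1r; exact: (imax j isT).
Qed.

(** A power of the augmentation ideal lying in all others would need exponents
    that are sums of arbitrarily many nonzero lattice points of the cone. *)
Lemma Jpow_separated (m : lattice S) : exists k, ~ Jpow C k m.
Proof.
have [k [G CG]] := Ccone; pose g := map_mx intr G : 'M[R]_(k, rk S).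
have [mu mu0 muP] := strict_cone_bound CG.
have [K K0 KP] := mulmx_bound g.
pose good (u : lattice S) (c : 'rV[R]_k) :=
  [/\ forall j, 0 <= c 0 j, forall j, row j G = 0 -> c 0 j = 0 &
      toR R u = c *m g].
have goodP u : pmon C u -> exists c, good u c.
  rewrite /pmon CG => -[c c0 ec].
  exists (\row_j (if row j G == 0 then 0 else c 0 j)); split.
  - by move=> j; rewrite mxE; case: ifP.
  - by move=> j Gj; rewrite mxE Gj eqxx.
  - rewrite ec !mulmx_sum_row; apply: eq_bigr => j _; rewrite mxE.
    case: eqP => // Gj; rewrite -map_row Gj.
    by rewrite (map_mx0 (intr : int -> R)) !scaler0.
have norm_le (c : 'rV[R]_k) : (forall j, 0 <= c 0 j) -> `|c| <= \sum_j c 0 j.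
  move=> c0; rewrite [leLHS]/Num.norm /= mx_normrE.
  apply/bigmax_leP; split=> [|[i j] _ /=]; first exact: sumr_ge0.
  rewrite (ord1 i) ger0_norm // (bigD1 j) //= lerDl.
  exact: sumr_ge0.
have JP l u : Jpow C l u -> exists2 c, good u c & l%:R <= K * \sum_j c 0 j.
  elim: l u => [|l IHl] u /=.
    move=> /goodP[c gc]; exists c => //; apply: mulr_ge0; first exact: ltW.
    by apply: sumr_ge0 => j _; case: gc.
  move=> [u1 [u2 [/goodP[c1 g1] u10 /IHl[c2 [c20 z2 e2] l2] ->]]].
  case: g1 => c10 z1 e1; exists (c1 + c2).
    split=> [j|j Gj|]; first by rewrite mxE addr_ge0.
      by rewrite mxE z1 // z2 // addr0.
    by rewrite toRD e1 e2 mulmxDl.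
  have -> : \sum_j (c1 + c2) 0 j = \sum_j c1 0 j + \sum_j c2 0 j.
    by rewrite -big_split; apply: eq_bigr => j _; rewrite mxE.
  rewrite mulrDr -natr1 addrC lerD //.
  rewrite (le_trans (norm_lattice_ge1 u10)) // e1 (le_trans (KP _)) //.
  by apply: ler_wpM2l; [exact: ltW | exact: norm_le].
have [l lP] : exists l : nat, K * (k%:R * (mu^-1 * `|toR R m|)) < l%:R.
  exists (Num.truncn (K * (k%:R * (mu^-1 * `|toR R m|)))).+1.
  exact: truncnS_gt.
exists l => /JP[c [c0 cz ec]].
apply/negP; rewrite -ltNge (le_lt_trans _ lP) //; apply: ler_wpM2l; first exact: ltW.
apply: (@le_trans _ _ (\sum_(j < k) mu^-1 * `|toR R m|)).
  apply: ler_sum => j _; rewrite mulrC ler_pdivlMr // mulrC ec; exact: muP.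
by rewrite sumr_const card_ord mulr_natl.
Qed.

End Cones.

(** * Avoiding countably many hyperplanes *)

Section Avoid.
Variables (R : realType) (n : nat).

Lemma finite_roots (p : {poly R}) : p != 0 -> finite_set [set s | root p s].
Proof.
elim: {p}_.+1 {-2}p (ltnSn (size p)) => // k IHk p pk p0.
have [nr|/existsNP[a /contrapT ra]] := pselect (forall s, ~ root p s).
  by rewrite (_ : [set s | _] = set0) //; apply/seteqP; split=> // s /nr.
have [q pE] := factor_theorem _ _ ra.
have q0 : q != 0 by apply: contra_neq p0 => q0; rewrite pE q0 mul0r.
have qk : (size q < k)%N.
  by move: pk; rewrite pE size_mul ?polyXsubC_eq0 // size_XsubC addn2.
apply: (@sub_finite_set _ _ ([set s | root q s] `|` [set a])); last first.
  by rewrite finite_setU; split; [exact: IHk | exact: finite_set1].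
by move=> s /=; rewrite pE rootM root_XsubC => /orP[|/eqP]; [left|right].
Qed.

(** Each hyperplane meets the moment curve through x in finitely many points, and
    a countable set of parameters does not exhaust an interval. *)
Lemma avoid_hyperplanes (I : countType) (phi : I -> 'cV[R]_n) (x : 'rV[R]_n)
    (e : R) : 0 < e ->
  exists2 y : 'rV[R]_n, `|y - x| < e &
    forall i, phi i != 0 -> (y *m phi i) 0 0 != 0.
Proof.
move=> e0; pose d := Num.min (e / 2) 1.
have d0 : 0 < d by rewrite lt_min ltr01 divr_gt0.
pose curve (s : R) : 'rV[R]_n := \row_j s ^+ j.+1.
pose p i : {poly R} := ((x *m phi i) 0 0)%:P + \sum_(j < n) phi i j 0 *: 'X^(j.+1).
have pE i s : (p i).[s] = ((x + curve s) *m phi i) 0 0.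
  rewrite /p hornerD hornerC horner_sum mulmxDl [RHS]mxE; congr (_ + _).
  rewrite [RHS]mxE; apply: eq_bigr => j _.
  by rewrite hornerZ hornerXn !mxE mulrC.
have p0 i : phi i != 0 -> p i != 0.
  apply: contra_neq => pi0; apply/colP => j; rewrite mxE.
  have := congr1 (fun q : {poly R} => q`_j.+1) pi0.
  rewrite /= coef0 coefD coefC /= add0r coef_sum (bigD1 j) //= big1 => [|k kj].
    by rewrite addr0 coefZ coefXn eqxx mulr1.
  by rewrite coefZ coefXn eqSS eq_sym (inj_eq val_inj) (negbTE kj) mulr0.
pose bad i : set R := [set s | phi i != 0 /\ root (p i) s].
have badc : countable (\bigcup_i bad i).
  apply: bigcup_countable => // i _; apply: finite_set_countable.
  have [ph0|ph0] := eqVneq (phi i) 0.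
    by apply: (sub_finite_set _ (@finite_set0 R)) => s []; rewrite ph0 eqxx.
  by apply: sub_finite_set (finite_roots (p0 i ph0)) => s [].
have [s sd sbad] : exists2 s : R, 0 < s < d & ~ (\bigcup_i bad i) s.
  apply: contrapT => /forall2NP H.
  have sub : `]0, d[%classic `<=` \bigcup_i bad i.
    by move=> s; rewrite /= in_itv /= => sd; case: (H s) => // /contrapT.
  have := countable_lebesgue_measure0 (sub_countable (subset_card_le sub) badc).
  rewrite lebesgue_measure_itv /= lte_fin d0 oppr0 adde0 => /eqP.
  by rewrite eqe gt_eqF.
have [s0 sd'] := andP sd.
exists (x + curve s).
  rewrite addrC addKr; apply: (@le_lt_trans _ _ s); last first.
    rewrite (lt_le_trans sd') // (le_trans (_ : d <= e / 2)) //.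
      by rewrite ge_min lexx.
    lra.
  rewrite [leLHS]/Num.norm /= mx_normrE.
  apply/bigmax_leP; split=> [|[i j] _ /=]; first exact: ltW.
  rewrite mxE ger0_norm ?exprn_ge0 ?(ltW s0) // exprS ler_piMr ?(ltW s0) //.
  by rewrite exprn_ile1 ?(ltW s0) // (le_trans (ltW sd')) // ge_min lexx orbT.
move=> i phi0; apply: contra_notN sbad => /eqP ys; exists i => //.
by split=> //; rewrite rootE pE ys.
Qed.
End Avoid.

(** * Walls and singular points *)

Section Walls.
Variables (R : realType) (S : seed).
Implicit Types (x y : MR R S) (v : lattice S).

Definition relint (w : wall R S) x : Prop :=
  exists2 e : R, 0 < e &
    forall y, perp (wnormal w) y -> `|y - x| < e -> wsupp w y.

Lemma not_wboundary_relint (w : wall R S) x : wsupp w x -> ~ wboundary w x -> relint w x.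
Proof.
move=> wx nb; apply: contrapT => nri; apply: nb; split=> // B /nbhs_rVP[e e0 eB].
apply: contrapT => nB; apply: nri; exists e => // y py yx; apply: contrapT => nwy.
by apply: nB; exists y; split=> //; exact: eB.
Qed.

Lemma perp_ker v x : perp v x <-> (x <= kermx (ncol R v))%MS.
Proof.
rewrite /perp /= pairRE; split=> [x0|/sub_kermxP ->]; last by rewrite mxE.
by apply/sub_kermxP/matrixP => i j; rewrite !ord1 x0 mxE.
Qed.

Lemma rank_perp v : v != 0 -> (\rank (kermx (ncol R v))).+1 = rk S.
Proof.
move=> v0; have v0' : ncol R v != 0 by apply: contra_neq v0 => /ncol_eq0.
have := mxrank_ker (ncol R v).
have -> : \rank (ncol R v) = 1%N.
  by apply/eqP; rewrite eqn_leq rank_leq_col lt0n mxrank_eq0.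
have : (0 < rk S)%N.
  rewrite lt0n; apply: contra_neq v0 => S0; apply/rowP => i.
  by have := leq_ltn_trans (leq0n i) (ltn_ord i); rewrite lt0n => /eqP.
by move=> ? ->; rewrite subn1 prednK.
Qed.

Lemma perp2_ker v v' x :
  (perp v x /\ perp v' x) <-> (x <= kermx (row_mx (ncol R v) (ncol R v')))%MS.
Proof.
split=> [[/perp_ker/sub_kermxP x1 /perp_ker/sub_kermxP x2]|/sub_kermxP].
  by apply/sub_kermxP; rewrite mul_mx_row x1 x2 row_mx0.
rewrite mul_mx_row -[0]row_mx0 => /eq_row_mx[x1 x2].
by split; apply/perp_ker/sub_kermxP.
Qed.

Lemma rank_perp2 v v' : v != 0 -> v' != 0 -> ~ parallel R v' v ->
  (\rank (kermx (row_mx (ncol R v) (ncol R v')))).+2 = rk S.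
Proof.
move=> v0 v'0 npar; rewrite mxrank_ker.
have : \rank (row_mx (ncol R v) (ncol R v')) = 2%N.
  apply/eqP; rewrite eqn_leq rank_leq_col ltnNge; apply/negP => rk1.
  by apply: npar; exact: rank1_parallel.
move=> rk2; rewrite rk2; have := rank_leq_row (row_mx (ncol R v) (ncol R v')).
by rewrite rk2; lia.
Qed.

(** The span of A contains x and its translates by small multiples of the rows
    of V, hence these rows. *)
Lemma open_spans k (V : 'M[R]_(k, rk S)) (A : set (MR R S)) x (e : R) :
    0 < e -> (x <= V)%MS ->
    (forall y, (y <= V)%MS -> `|y - x| < e -> A y) ->
  has_dim (A `&` [set y | (y <= V)%MS]) (\rank V).
Proof.
move=> e0 xV eA.
pose c i : R := e / (1 + `|row i V|).
have c0 i : 0 < c i by rewrite divr_gt0 // ltr_pwDl.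
pose Z := col_mx x (\matrix_i (x + c i *: row i V)).
have ZA i : A (row i Z) /\ (row i Z <= V)%MS.
  case: (splitP i) => j ij.
    have -> : i = lshift k j by exact: val_inj.
    rewrite rowKu row_id; split=> //; apply: eA => //.
    by rewrite subrr normr0.
  have -> : i = rshift 1 j by exact: val_inj.
  have xcV : ((x + c j *: row j V)%R <= V)%MS.
    by apply: addmx_sub => //; apply: scalemx_sub; exact: row_sub.
  rewrite rowKd rowK; split=> //; apply: eA => //.
  rewrite addrC addKr normrZ gtr0_norm // /c mulrAC -mulrA gtr_pMr //.
  by rewrite ltr_pdivrMr ?ltr_pwDl // mul1r ltrDr.
have ZV : (Z :=: V)%MS.
  apply/eqmxP/andP; split.
    by apply/row_subP => i; case: (ZA i).
  apply/row_subP => i.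
  have -> : row i V = (c i)^-1 *: ((x + c i *: row i V) - x).
    by rewrite addrC addKr scalerA mulVf ?scale1r // gt_eqF.
  apply: scalemx_sub; apply: addmx_sub.
    by have := row_sub (rshift 1 i) Z; rewrite rowKd rowK.
  rewrite eqmx_opp; have := row_sub (lshift k 0) Z.
  by rewrite rowKu row_id.
rewrite -ZV; exists (rowsub (maxrankfun Z) Z); split.
- exact: maxrowsub_free.
- by move=> i; rewrite row_rowsub; case: (ZA (maxrankfun Z i)).
- by move=> y [_ /= yV]; rewrite eq_maxrowsub ZV.
Qed.

Lemma has_dim_le (A B : set (MR R S)) r q :
  has_dim A r -> has_dim B q -> A `<=` B -> (r <= q)%N.
Proof.
move=> [M [Mfree MA _]] [N [_ _ NB]] AB.
rewrite -(eqP (Mfree : \rank M == r)) (leq_trans _ (rank_leq_row N)) // mxrankS //.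
by apply/row_subP => i; apply: NB; apply: AB.
Qed.

Variables (W : choiceType) (D : W -> wall R S).
Hypothesis Dwall : forall w, is_wall (D w).

Let wn0 w : wnormal (D w) != 0.
Proof. by case: (Dwall w) => /Nplus_neq0. Qed.

Let wperp w x : wsupp (D w) x -> perp (wnormal (D w)) x.
Proof. by case: (Dwall w) => _ + _ _ _; exact. Qed.

(** At a common interior point, two walls with different hyperplanes meet in
    codimension two, which makes the point singular. *)
Lemma nonsing_parallel w1 w2 x : ~ Sing D x ->
  wsupp (D w1) x -> wsupp (D w2) x ->
  parallel R (wnormal (D w1)) (wnormal (D w2)).
Proof.
move=> nsx w1x w2x; apply: contrapT => npar.
have [|e1 e10 e1P] := @not_wboundary_relint (D w1) x w1x.
  by move=> b; apply: nsx; left; exists w1.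
have [|e2 e20 e2P] := @not_wboundary_relint (D w2) x w2x.
  by move=> b; apply: nsx; left; exists w2.
apply: nsx; right; exists w1, w2; split=> //.
pose V := kermx (row_mx (ncol R (wnormal (D w2))) (ncol R (wnormal (D w1)))).
exists (\rank V); first exact: rank_perp2.
have e0 : 0 < Num.min e1 e2 by rewrite lt_min e10.
have [||B [Bf BA BV]] := @open_spans _ V (wsupp (D w1) `&` wsupp (D w2)) x _ e0.
- by apply/perp2_ker; split; exact: wperp.
- move=> y /perp2_ker[y2 y1]; rewrite lt_min => /andP[ye1 ye2].
  by split; [exact: e1P | exact: e2P].
exists B; split=> // [i|y [y1 y2]]; first by case: (BA i).
by apply: BV; split=> //; apply/perp2_ker; split; exact: wperp.
Qed.

(** A wall spans its hyperplane, which determines its normal up to scaling. *)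
Lemma wall_normal_unique w v : v != 0 -> wsupp (D w) `<=` perp v ->
  parallel R v (wnormal (D w)).
Proof.
move=> v0 wv; have [_ wp _ [r rS [B [Bf BA _]]] _] := Dwall w.
apply: rank1_parallel => //.
set N := row_mx _ _.
have BN : (B <= kermx N)%MS.
  by apply/row_subP => i; apply/perp2_ker; split; [exact: wp | exact: wv].
have := mxrankS BN; rewrite mxrank_ker (eqP (Bf : \rank B == r)).
have := rank_leq_row N; move: (\rank N) rS => q; lia.
Qed.

(** The countably many subspaces that contain all singular points: spans of
    lattice vectors and intersections of two rational hyperplanes. *)
Definition sub_index (n : nat) : countType :=
  ({k : nat & 'M[int]_(k, n)} + 'rV[int]_n * 'rV[int]_n)%type.

Definition sub_space (a : sub_index (rk S)) : 'M[R]_(rk S) :=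
  match a with
  | inl G => <<map_mx intr (tagged G)>>%MS
  | inr vv => kermx (row_mx (ncol R (S := S) vv.1) (ncol R (S := S) vv.2))
  end.

(** A point of a finitely generated cone that needs a spanning set of generators
    is interior, since the coefficients may vary freely around positive ones. *)
Lemma wboundary_sub w x : wboundary (D w) x ->
  exists2 a, ((\rank (sub_space a)).+2 <= rk S)%N & (x <= sub_space a)%MS.
Proof.
move=> [wx bx]; have [_ wp [k [G GE]] [r rS _] _] := Dwall w.
have := wx; rewrite GE => -[c c0 xE].
pose G' := \matrix_(i, j) (if 0 < c 0 i then G i j else 0).
pose g := map_mx intr G' : 'M[R]_(k, rk S).
exists (inl (Tagged (fun k => 'M[int]_(k, rk S)) G')); last first.
  rewrite genmxE /= xE !mulmx_sum_row; apply: summx_sub => i _.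
  have [ci|ci] := boolP (0 < c 0 i); last first.
    by rewrite (_ : c 0 i = 0) ?scale0r ?sub0mx //; move: ci; rewrite lt0r c0 andbT negbK => /eqP.
  apply: scalemx_sub; have -> : row i (map_mx intr G) = row i g.
    by apply/rowP => j; rewrite !mxE ci.
  exact: row_sub.
rewrite genmxE /= -/g leqNgt; apply/negP => rk_g.
pose K := kermx (ncol R (wnormal (D w))).
have gleK : (g <= K)%MS.
  apply/row_subP => i; have [ci|ci] := boolP (0 < c 0 i); last first.
    rewrite (_ : row i g = 0) ?sub0mx //; apply/rowP => j.
    by rewrite !mxE (negbTE ci).
  apply/perp_ker; apply: wp; rewrite GE; exists (delta_mx 0 i).
    by move=> j; rewrite mxE; case: (_ && _).
  by rewrite -rowE; apply/rowP => j; rewrite !mxE ci.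
have gK : (K <= g)%MS.
  rewrite -(mxrank_leqif_sup gleK) eqn_leq mxrankS //=.
  by have := rank_perp (wn0 w); rewrite -/K => rk_K; lia.
have [K0 K00 K0P] := mulmx_bound (pinvmx g).
pose m := \big[Num.min/1]_(i | 0 < c 0 i) c 0 i.
have m0 : 0 < m by apply: lt_bigmin.
have mle i : 0 < c 0 i -> m <= c 0 i by move=> ci; exact: bigmin_le_cond.
have [|y [[/= py nwy] /= yx]] := bx [set y | `|y - x| < m / K0].
  by apply/nbhs_rVP; exists (m / K0) => //; rewrite divr_gt0.
apply: nwy; rewrite GE; pose d := (y - x) *m pinvmx g.
have dg : d *m g = y - x.
  apply: mulmxKpV; apply: submx_trans gK; apply: addmx_sub.
    exact/perp_ker.
  by rewrite eqmx_opp; apply/perp_ker; exact: wp.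
exists (\row_i (c 0 i + if 0 < c 0 i then d 0 i else 0)).
  move=> i; rewrite mxE; case: ifP => [ci|_]; last by rewrite addr0.
  have di : `|d 0 i| <= c 0 i.
    apply: le_trans (coord_le_norm _ _) _; apply: le_trans (K0P _) _.
    by apply: le_trans (mle i ci); rewrite mulrC -ler_pdivlMr // ltW.
  by move: di; rewrite ler_norml; lra.
rewrite -[y](subrK x) -dg xE !mulmx_sum_row -big_split /=.
apply: eq_bigr => i _; rewrite mxE scalerDl addrC; congr (_ + _).
case: ifP => ci; first by congr (_ *: _); apply/rowP => j; rewrite !mxE ci.
rewrite scale0r (_ : row i g = 0) ?scaler0 //; apply/rowP => j.
by rewrite !mxE ci.
Qed.

(** Near a point interior to both, two walls coincide with their hyperplanes. If
    these are equal, the walls meet in codimension one instead of two. *)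
Lemma sing_sub x : Sing D x ->
  exists2 a, ((\rank (sub_space a)).+2 <= rk S)%N & (x <= sub_space a)%MS.
Proof.
case=> [[w _]|[w1 [w2 [[w1x w2x] [r rS Ar]]]]]; first exact: wboundary_sub.
have [b1|nb1] := pselect (wboundary (D w1) x); first exact: wboundary_sub b1.
have [b2|nb2] := pselect (wboundary (D w2) x); first exact: wboundary_sub b2.
have [e1 e10 e1P] := not_wboundary_relint w1x nb1.
have [e2 e20 e2P] := not_wboundary_relint w2x nb2.
have e0 : 0 < Num.min e1 e2 by rewrite lt_min e10.
have [par|npar] := pselect (parallel R (wnormal (D w1)) (wnormal (D w2))).
  exfalso.
  have H := @open_spans _ (kermx (ncol R (wnormal (D w2))))
    (wsupp (D w1) `&` wsupp (D w2)) x _ e0.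
  have /H{}H : (x <= kermx (ncol R (wnormal (D w2))))%MS.
    by apply/perp_ker; exact: wperp.
  have /H{}H : forall y, (y <= kermx (ncol R (wnormal (D w2))))%MS ->
      `|y - x| < Num.min e1 e2 -> (wsupp (D w1) `&` wsupp (D w2)) y.
    move=> y /perp_ker y2; rewrite lt_min => /andP[ye1 ye2].
    split; [apply: e1P => //| exact: e2P].
    by apply/eqP; rewrite (parallel_eq0 _ par); apply/eqP.
  have := has_dim_le H Ar (@subIsetl _ _ _).
  by have := rank_perp (wn0 w2); lia.
exists (inr (wnormal (D w2), wnormal (D w1))) => /=.
  by rewrite rank_perp2.
by apply/perp2_ker; split; exact: wperp.
Qed.

End Walls.

(** * Piecewise linear paths with prescribed exponents *)

Section Path.
Variables (R : realType) (S : seed).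
Variables (s : nat) (f nu : nat -> lattice S).

(** Bends are numbered backwards, from the endpoint Q of the path: line number i
    carries the exponent f i and is [line i Q - t f_i] at time t. It leaves the
    hyperplane orthogonal to nu i at time [time i Q]. *)
Fixpoint line (i : nat) (Q : MR R S) : MR R S :=
  if i is i'.+1 then
    line i' Q + (pairR (nu i') (line i' Q) / pairR (nu i') (toR R (f i'))) *:
                toR R (f i'.+1 - f i')
  else Q.

Definition time i Q : R := pairR (nu i) (line i Q) / pairR (nu i) (toR R (f i)).
Definition bend i Q : MR R S := line i Q - time i Q *: toR R (f i).

(** The maximum switches on the change of exponent at bend i for the times before
    T i; in this form the path is continuous in Q, T and t together. *)
Definition pl_path (Q : MR R S) (T : nat -> R) (t : R) : MR R S :=
  Q - t *: toR R (f 0) +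
  \sum_(i < s) Num.max 0 (T i - t) *: toR R (f i.+1 - f i).

Lemma lineS i Q : line i.+1 Q = line i Q + time i Q *: toR R (f i.+1 - f i).
Proof. by []. Qed.

Lemma line_sum i Q :
  line i Q = Q + \sum_(j < i) time j Q *: toR R (f j.+1 - f j).
Proof.
elim: i => [|i IHi]; first by rewrite big_ord0 addr0.
by rewrite lineS IHi big_ord_recr /= addrA.
Qed.

Lemma bend_perp i Q : pairR (nu i) (toR R (f i)) != 0 -> perp (nu i) (bend i Q).
Proof. by move=> nf; rewrite /perp /= /bend pairRB pairRZ divfK // subrr. Qed.

Lemma pl_path_line i Q t : (i <= s)%N ->
  (forall j, (j < i)%N -> t <= time j Q) ->
  (forall j, (i <= j)%N -> (j < s)%N -> time j Q <= t) ->
  pl_path Q (time^~ Q) t = line i Q - t *: toR R (f i).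
Proof.
move=> is_ ti it; rewrite /pl_path line_sum.
rewrite -(big_mkord xpredT
  (fun j => Num.max 0 (time j Q - t) *: toR R (f j.+1 - f j))).
rewrite (@big_cat_nat _ _ _ i) //= [X in _ + (_ + X)]big_nat_cond [X in _ + (_ + X)]big1 ?addr0; last first.
  move=> j /andP[/andP[ij js] _].
  by rewrite max_l ?scale0r // subr_le0 it.
rewrite (@eq_big_nat _ _ _ 0%N i _
   (fun j => time j Q *: toR R (f j.+1 - f j) - t *: toR R (f j.+1 - f j))).
  2: by move=> j /andP[_ ji]; rewrite max_r ?scalerBl // subr_ge0 ti.
rewrite big_split /= big_mkord -addrA -[RHS]addrA; congr (_ + _).
rewrite addrCA; congr (_ + _).
have -> : \sum_(0 <= j < i) - (t *: toR R (f j.+1 - f j)) =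
          - (t *: \sum_(0 <= j < i) (toR R (f j.+1) - toR R (f j))).
  by rewrite scaler_sumr -sumrN; apply: eq_bigr => j _; rewrite toRB.
by rewrite telescope_sumr // scalerBr opprB addrA addNr add0r.
Qed.

Lemma weak_decr (T : nat -> R) :
  (forall i, (i.+1 < s)%N -> T i.+1 <= T i) ->
  forall i j, (i <= j)%N -> (j < s)%N -> T j <= T i.
Proof.
move=> dT i j; elim: j => [|j IHj]; first by rewrite leqn0 => /eqP ->.
rewrite leq_eqVlt => /orP[/eqP -> //|ij] js.
by apply: le_trans (dT j js) (IHj _ _) => //; apply: ltnW.
Qed.

Lemma pl_path_dom i Q t : (i <= s)%N ->
  (forall i, (i.+1 < s)%N -> time i.+1 Q <= time i Q) ->
  ((0 < i)%N -> t <= time i.-1 Q) -> ((i < s)%N -> time i Q <= t) ->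
  pl_path Q (time^~ Q) t = line i Q - t *: toR R (f i).
Proof.
move=> is_ dT ti it; apply: pl_path_line => // j.
  case: i is_ ti {it} => // i /= is_ ti ji.
  by apply: le_trans (ti isT) _; apply: (@weak_decr (time^~ Q)).
move=> ij js; apply: le_trans (it (leq_ltn_trans ij js)).
exact: (@weak_decr (time^~ Q)).
Qed.

Lemma find_dom (T : nat -> R) t : exists i, [/\ (i <= s)%N,
  (0 < i)%N -> t <= T i.-1 & (i < s)%N -> T i <= t].
Proof.
elim: s => [|k [i [ik ti it]]]; first by exists 0%N.
case: (ltnP i k) => [ik'|ki].
  by exists i; split=> // [|_]; [exact: ltnW|exact: it].
have {ik ki it} ei : i = k by apply/eqP; rewrite eqn_leq ik.
rewrite ei in ti; have [tk|kt] := leP t (T k).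
  by exists k.+1; split=> //; rewrite ltnn.
by exists k; split=> // _; exact: ltW.
Qed.

(** Each bend contributes a shear, as nu takes the same value on the exponents
    before and after it. Invertibility makes generic endpoints give generic
    lines. *)
Lemma line_mx i :
  (forall j, (j < i)%N -> pairR (nu j) (toR R (f j.+1)) = pairR (nu j) (toR R (f j))) ->
  exists2 M, M \in unitmx & forall Q, line i Q = Q *m M.
Proof.
elim: i => [|i IHi] Hi.
  by exists 1%:M; [exact: unitmx1 | move=> Q; rewrite mulmx1].
have [|M Mu ME] := IHi; first by move=> j ji; apply: Hi; rewrite ltnW.
pose u : 'cV[R]_(rk S) := (pairR (nu i) (toR R (f i)))^-1 *: ncol R (nu i).
pose v : 'rV[R]_(rk S) := toR R (f i.+1 - f i).
have vu : v *m u = 0.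
  apply/matrixP => a b; rewrite !ord1 -scalemxAr mxE -pairRE /v toRB pairRB.
  by rewrite Hi // subrr mulr0 mxE.
exists (M *m (1%:M + u *m v)).
  rewrite unitmx_mul Mu /=.
  apply: (proj1 (@mulmx1_unit _ _ _ (1%:M - u *m v) _)).
  rewrite mulmxDl mul1mx mulmxBr mulmx1 -!mulmxA (mulmxA v) vu mul0mx mulmx0.
  by rewrite subr0 subrK.
move=> Q; rewrite /= ME mulmxA mulmxDr mulmx1 mulmxA; congr (_ + _).
rewrite -mul_scalar_mx; congr (_ *m _).
apply/matrixP => a b; rewrite !ord1 /u -scalemxAr [RHS]mxE -pairRE.
by rewrite mxE eqxx mulr1n mulrC.
Qed.

Lemma pairR_continuous (v : lattice S) : continuous (@pairR R S v).
Proof.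
move=> x; have FF : Filter (nbhs x) by exact: nbhs_filter.
have [K K0 KP] := mulmx_bound (ncol R v).
apply/cvgrPdist_lt => e e0; apply/nbhs_rVP.
exists (e / K); first by rewrite divr_gt0.
move=> y yx; rewrite distrC -pairRB pairRE (le_lt_trans (coord_le_norm _ 0)) //.
by rewrite (le_lt_trans (KP _)) // mulrC -ltr_pdivlMr.
Qed.

Hypothesis flat : forall i, (i < s)%N ->
  pairR (nu i) (toR R (f i.+1)) = pairR (nu i) (toR R (f i)).

Lemma line_continuous i : (i <= s)%N -> continuous (line i).
Proof.
move=> si; have [|M _ ME] := @line_mx i.
  by move=> j ji; apply: flat; exact: leq_trans si.
by rewrite (_ : line i = fun Q => Q *m M);
  [exact: mulmx_continuous | exact/funext].
Qed.

Lemma time_continuous i : (i < s)%N -> continuous (time i).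
Proof.
move=> si Q; have FF : Filter (nbhs Q) by exact: nbhs_filter.
rewrite /time; apply: cvgM; last exact: cvg_cst.
apply: (@cvg_comp _ _ _ (line i) (pairR (nu i))).
  by apply: line_continuous; exact: ltnW.
exact: pairR_continuous.
Qed.

Lemma bend_continuous i : (i < s)%N -> continuous (bend i).
Proof.
move=> si Q; have FF : Filter (nbhs Q) by exact: nbhs_filter.
rewrite /bend; apply: cvgB.
  by apply: line_continuous; exact: ltnW.
by apply: cvgZr_tmp; exact: time_continuous.
Qed.

Lemma pl_path_cvg (X : Type) (F : set_system X) (FF : Filter F)
    (Qx : X -> MR R S) (Tx : X -> nat -> R) (tx : X -> R) Q T t :
  Qx @ F --> Q -> (forall i, (i < s)%N -> Tx x i @[x --> F] --> T i) ->
  tx @ F --> t ->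
  pl_path (Qx x) (Tx x) (tx x) @[x --> F] --> pl_path Q T t.
Proof.
move=> cQ cT ct; rewrite /pl_path; apply: cvgD.
  by apply: cvgB => //; exact: cvgZr_tmp.
apply: cvg_big => [|i _]; first exact: add_continuous.
apply: cvgZr_tmp.
have mc : continuous (fun a : R => Num.max 0 a).
  move=> a; apply: (@continuous_max R R (cst 0) idfun a); first exact: cvg_cst.
  exact: cvg_id.
apply: (@cvg_comp _ _ _ (fun x => Tx x i - tx x) (fun a => Num.max 0 a)).
  by apply: cvgB ct; apply: cT.
exact: mc.
Qed.

End Path.

(** * Broken lines with prescribed exponents and walls *)

Section Sides.
Variables (R : realType) (S : seed) (C : set (MR R S)).
Hypothesis HC : monoid_cone C.
Variables (W : choiceType) (D : W -> wall R S) (c : W -> nat).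
Hypothesis Dscat : scattering_diagram C D.
Hypothesis wserD : forall w, pos_upto (wser (D w)) (c w).
Hypothesis c_gt0 : forall w, (0 < c w)%N.

Let Dwall w : is_wall (D w). Proof. by case: Dscat. Qed.

Let wNplus w : Nplus (wnormal (D w)). Proof. by case: (Dwall w). Qed.

Let wNuf w : Nuf_of (uf S) (wnormal (D w)). Proof. by case: (wNplus w). Qed.

(** A bend from m to m', with the walls that contribute to it; u w is the
    multiple of the direction of w that is added. *)
Definition bends_by (m m' : lattice S) (cs : seq W) (u : W -> nat) : Prop :=
  [/\ uniq cs, forall w, w \in cs -> (0 < u w <= cross_exp (D w) m * c w)%N,
      m' = m + \sum_(w <- cs) p1 (wnormal (D w)) *+ u w & m' != m].

(** A wall trivial modulo a power of the ideal that misses the total change of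
    exponent cannot contribute, since its own direction lies in that power. *)
Lemma bends_by_not_one_mod k m m' cs u w : bends_by m m' cs u -> w \in cs ->
  ~ Jpow C k (m' - m) -> ~ one_mod C k (D w).
Proof.
move=> [ucs ub -> _] wcs nJ om; apply: nJ; rewrite addrC addKr.
have /andP[u0 _] := ub w wcs.
rewrite (perm_big _ (perm_to_rem wcs)) big_cons /= -(prednK u0) mulrS -addrA.
apply: (Jpow_D HC).
  have := om 1%N isT; rewrite mulr1n; apply.
  by rewrite gt_eqF // (wserD w).1.
apply: (pmon_D HC); first by apply: (pmon_Mn HC); exact: (p1_pmon HC).
apply: (pmon_sum HC) => w' _; apply: (pmon_Mn HC); exact: (p1_pmon HC).
Qed.

(** One of the two rays in combinatorial form: the exponents f, vectors nu
    orthogonal to the bends, the wall wl recorded for each bend, and the walls cs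
    that contribute to it with their multiples u. Index 0 is at the endpoint. *)
Record side := Side {
  sd_n : nat;
  sd_f : nat -> lattice S;
  sd_nu : nat -> lattice S;
  sd_wl : nat -> W;
  sd_cs : nat -> seq W;
  sd_u : nat -> W -> nat }.

Record admissible (d : side) : Prop := Admissible {
  adm_nz : forall i, (i < sd_n d)%N -> pairR (sd_nu d i) (toR R (sd_f d i)) != 0;
  adm_bend : forall i, (i < sd_n d)%N ->
    bends_by (sd_f d i.+1) (sd_f d i) (sd_cs d i) (sd_u d i);
  adm_par : forall i w, (i < sd_n d)%N -> w \in sd_wl d i :: sd_cs d i ->
    parallel R (sd_nu d i) (wnormal (D w));
  adm_init : sd_f d (sd_n d) != 0 }.

Section OneSide.
Variables (d : side) (Hd : admissible d).
Local Notation s := (sd_n d).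
Local Notation f := (sd_f d).
Local Notation nu := (sd_nu d).
Local Notation wl := (sd_wl d).
Local Notation cs := (sd_cs d).

Lemma adm_flat i : (i < s)%N ->
  pairR (nu i) (toR R (f i.+1)) = pairR (nu i) (toR R (f i)).
Proof.
move=> si; have [_ _ -> _] := adm_bend Hd si.
rewrite toRD pairRD toR_sum pairR_sum big_seq big1 ?addr0 // => w wcs.
rewrite toRMn pairRZ (@parallel_p1 R S) ?mulr0 //.
by apply: adm_par => //; rewrite inE wcs orbT.
Qed.

(** The conditions on the endpoint that persist near a suitable endpoint, as
    opposed to those of [avoids], which hold for a generic one. *)
Definition ordered (Q : MR R S) : Prop :=
  [/\ forall i, (i < s)%N -> time f nu i Q < 0,
      forall i, (i.+1 < s)%N -> time f nu i.+1 Q < time f nu i Q &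
      forall i w, (i < s)%N -> w \in wl i :: cs i ->
        wsupp (D w) (bend f nu i Q)].

Definition avoids (Q : MR R S) : Prop :=
  ~ Supp D Q /\
  forall i t, (i <= s)%N -> ~ Sing D (line f nu i Q - t *: toR R (f i)).

(** Truncation levels that see the change of exponent at each bend. Since they do
    not depend on the endpoint, finitely many walls matter for all endpoints. *)
Definition levels (kappa : nat -> nat) (en : nat -> seq W) : Prop :=
  forall i, [/\ ~ Jpow C (kappa i) (f i - f i.+1), uniq (en i) &
    forall w, w \in en i <-> ~ one_mod C (kappa i) (D w)].

Lemma levels_exist : exists kappa en, levels kappa en.
Proof.
have H i : exists ke : nat * seq W, [/\ ~ Jpow C ke.1 (f i - f i.+1),
    uniq ke.2 & forall w, w \in ke.2 <-> ~ one_mod C ke.1 (D w)].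
  have [k kP] := Jpow_separated HC (f i - f i.+1).
  have [_ /(_ k)/finite_seqP[l lE]] := Dscat.
  exists (k, undup l); split=> //=; first exact: undup_uniq.
  by move=> w; rewrite mem_undup; have /seteqP[h1 h2] := lE; split=> [/h2|/h1].
have [g gP] := choice H.
by exists (fun i => (g i).1), (fun i => (g i).2).
Qed.

Section Ray.
Variables (kappa : nat -> nat) (en : nat -> seq W) (inc : nat -> pred W).
Hypothesis Hlev : levels kappa en.

Fixpoint coef (j : nat) : R[i] :=
  if j is j'.+1 then
    let i := (s - j)%N in
    cross_walls D [seq w <- en i | inc i w] (f i.+1) (coef j') (f i)
  else 1.

(** The lists of a ray start at infinity, where its last bend is. *)
Definition ray (Q : MR R S) : dray R S W :=
  Dray (pl_path s f Q (fun i => time f nu i Q))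
       (mkseq (fun j => time f nu (s - j.+1) Q) s)
       (mkseq (fun j => (coef j, f (s - j))) s.+1)
       (mkseq (fun j => wl (s - j.+1)) s).

Lemma ray_times_nth Q j : (j < s)%N ->
  nth 0 (dr_times (ray Q)) j = time f nu (s - j.+1) Q.
Proof. by move=> js; rewrite nth_mkseq. Qed.

Lemma ray_exp Q j : (j <= s)%N -> dr_exp (ray Q) j = f (s - j).
Proof. by move=> js; rewrite /dr_exp nth_mkseq. Qed.

Lemma ray_coef Q j : (j <= s)%N -> dr_coef (ray Q) j = coef j.
Proof. by move=> js; rewrite /dr_coef nth_mkseq. Qed.

Lemma ray_linear Q :
  (forall i, (i < s)%N -> time f nu i Q <= 0) ->
  (forall i, (i.+1 < s)%N -> time f nu i.+1 Q <= time f nu i Q) ->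
  linear_ray (ray Q).
Proof.
move=> neg dT; split; rewrite ?size_mkseq //.
- apply/(sortedP 0) => j; rewrite size_mkseq => js.
  rewrite !nth_mkseq //; last exact: ltnW.
  have -> : (s - j.+1 = (s - j.+2).+1)%N by lia.
  by apply: dT; lia.
- apply/(all_nthP 0) => j; rewrite size_mkseq => js.
  by rewrite nth_mkseq //; apply: neg; lia.
move=> j t u js.
have dom v : in_domain (dr_times (ray Q)) j v ->
    dr_path (ray Q) v = line f nu (s - j) Q - v *: toR R (f (s - j)).
  move=> [lo hi]; apply: pl_path_dom => //; first exact: leq_subr.
    move=> sj; move: hi; rewrite ray_times_nth; last by lia.
    by rewrite subnS.
  move=> sj; move: lo; rewrite ray_times_nth; last by lia.
  by rewrite prednK; [apply; lia | lia].
move=> /dom -> /dom ->; rewrite ray_exp //.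
by rewrite opprB addrC addrA subrK scaleNr scalerBl opprB.
Qed.

Lemma ray_path_start Q : (forall i, (i < s)%N -> time f nu i Q <= 0) ->
  dr_path (ray Q) 0 = Q.
Proof.
move=> neg; rewrite /ray /= (@pl_path_line _ _ _ _ _ 0%N) //.
  by rewrite scale0r subr0.
by move=> j _; exact: neg.
Qed.

Lemma ray_path_bend Q i : (i < s)%N ->
  (forall i, (i.+1 < s)%N -> time f nu i.+1 Q <= time f nu i Q) ->
  dr_path (ray Q) (time f nu i Q) = bend f nu i Q.
Proof.
move=> si dT; rewrite /ray /= (@pl_path_dom _ _ _ _ _ i) //; first exact: ltnW.
case: i si => // i si _; exact: dT.
Qed.

Section Generic.
Variable Q : MR R S.
Hypotheses (Qord : ordered Q) (Qav : avoids Q).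
Hypothesis Hinc : forall i w, (i < s)%N -> w \in en i ->
  inc i w = `[< wsupp (D w) (bend f nu i Q) >].

Let neg i : (i < s)%N -> time f nu i Q < 0.
Proof. by case: Qord => + _ _; exact. Qed.

Let decr i : (i.+1 < s)%N -> time f nu i.+1 Q < time f nu i Q.
Proof. by case: Qord => _ + _; exact. Qed.

Let bend_nonsing i : (i < s)%N -> ~ Sing D (bend f nu i Q).
Proof. by move=> si; apply: Qav.2; exact: ltnW. Qed.

Let crossing_walls i : (i < s)%N -> forall w, w \in [seq w <- en i | inc i w] <->
  wsupp (D w) (bend f nu i Q) /\ ~ one_mod C (kappa i) (D w).
Proof.
move=> si w; have [_ _ enP] := Hlev i; rewrite mem_filter; split.
  by move=> /andP[incw we]; split; [move: incw; rewrite Hinc // => /asboolP | exact/enP].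
move=> [wb /enP we]; rewrite we andbT Hinc //; exact/asboolP.
Qed.

Lemma crossing_reaches i : (i < s)%N ->
  along D [seq w <- en i | inc i w] /\
  exists u, reaches D c [seq w <- en i | inc i w] (f i.+1) (f i) u.
Proof.
move=> si; have [nJ uen enP] := Hlev i; split.
  move=> w w' /(crossing_walls si)[wb _] /(crossing_walls si)[w'b _].
  apply: (@parallel_p1 R S) => //.
  exact: (nonsing_parallel Dwall (bend_nonsing si) wb w'b).
have bd := adm_bend Hd si; have [ucs ub fE _] := bd.
exists (fun w => if w \in cs i then sd_u d i w else 0%N); split.
  by move=> w _; case: ifP => // /ub /andP[].
rewrite {1}fE; congr (_ + _).
have sub w : w \in cs i -> w \in [seq w <- en i | inc i w].
  move=> wcs; apply/(crossing_walls si); split.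
    by case: Qord => _ _; apply=> //; rewrite inE wcs orbT.
  exact: bends_by_not_one_mod bd wcs nJ.
rewrite [RHS](eq_bigr (fun w => if w \in cs i
    then p1 (wnormal (D w)) *+ sd_u d i w else 0)); last first.
  by move=> w _; case: ifP.
rewrite -big_mkcond -big_filter; apply: perm_big; apply: uniq_perm => //.
  by apply: filter_uniq; apply: filter_uniq.
by move=> w; rewrite mem_filter; case: (boolP (w \in cs i)) => //= /sub ->.
Qed.

Lemma coef_gt0 j : (j <= s)%N -> 0 < coef j.
Proof.
elim: j => [|j IHj] js /=; first exact: ltr01.
have si : (s - j.+1 < s)%N by lia.
have [al [u uP]] := crossing_reaches si.
apply: (cross_walls_gt0 wserD) al (IHj (ltnW js)) uP.
by apply: filter_uniq; have [] := Hlev (s - j.+1)%N.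
Qed.

Lemma ray_continuous : continuous (dr_path (ray Q)).
Proof.
move=> t.
by apply: (@pl_path_cvg R S s f R (nbhs t) _ (fun=> Q)
  (fun=> fun i => time f nu i Q) id) => [||];
  [exact: cvg_cst | move=> i _; exact: cvg_cst | exact: cvg_id].
Qed.

Lemma ray_proper K : compact K ->
  compact ([set t : R | t <= 0] `&` dr_path (ray Q) @^-1` K).
Proof.
move=> cK; have [B [Breal BK]] := compact_bounded cK.
have {}BK x : K x -> `|x| <= B + 1 by apply: BK; rewrite ltrDl.
have f0 : 0 < `|toR R (f s)|.
  rewrite normr_gt0; apply: contra_neq (adm_init Hd) => fs0.
  by apply: (@toR_inj R S); rewrite fs0 toR0.
pose lo := - ((B + 1 + `|line f nu s Q|) / `|toR R (f s)|).
pose low := Num.min lo (time f nu s.-1 Q).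
apply: (@subclosed_compact _ _ `[low, 0]).
- apply: closedI; first exact: closed_le.
  apply: closed_comp; first by move=> t _; exact: ray_continuous.
  by apply: compact_closed => //; exact: norm_hausdorff.
- exact: segment_compact.
move=> t [/= t0 Kt]; rewrite in_itv /= t0 andbT /low ge_min.
have [//|tlast] := boolP (time f nu s.-1 Q <= t); first by rewrite orbT.
rewrite orbF; have := BK _ Kt.
rewrite (@pl_path_dom _ _ _ _ _ s) // ?ltnn //; last first.
  by move=> _; apply: ltW; rewrite ltNge.
  by move=> i si; exact: ltW (decr si).
move=> nrm; rewrite /lo lerNl ler_pdivlMr //.
have -> : - t * `|toR R (f s)| = `|t *: toR R (f s)|.
  by rewrite normrZ ler0_norm.
have -> : t *: toR R (f s) =
    line f nu s Q - (line f nu s Q - t *: toR R (f s)) by rewrite opprB addrC subrK.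
by rewrite (le_trans (ler_normB _ _)) // addrC lerD2r.
Qed.

(** The walls through a bend that are nontrivial at the chosen level include the
    prescribed ones, so the prescribed change of exponent occurs. *)
Lemma ray_generic : generic_broken_line C D (ray Q).
Proof.
have neg' i : (i < s)%N -> time f nu i Q <= 0 by move=> /neg/ltW.
have decr' i : (i.+1 < s)%N -> time f nu i.+1 Q <= time f nu i Q.
  by move=> /decr/ltW.
split.
- exact: ray_linear.
- split.
  + exact/continuous_subspaceT/ray_continuous.
  + exact: ray_proper.
  + move=> t t0; have [i [si ti it]] := find_dom s (fun i => time f nu i Q) t.
    by rewrite /ray /= (@pl_path_dom _ _ _ _ _ i) //; apply: Qav.2.
  + by rewrite ray_path_start //; case: Qav.
- split.
    apply/(sortedP 0) => j; rewrite size_mkseq => js.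
    rewrite !nth_mkseq //; last exact: ltnW.
    have -> : (s - j.+1 = (s - j.+2).+1)%N by lia.
    by apply: decr; lia.
  apply/(all_nthP 0) => j; rewrite size_mkseq => js.
  by rewrite nth_mkseq //; apply: neg; lia.
- rewrite ray_exp // ray_coef // subn0; split=> //; exact: adm_init.
move=> j w0; rewrite size_mkseq => js x.
have si : (s - j.+1 < s)%N by lia.
have xE : x = bend f nu (s - j.+1) Q.
  by rewrite /x ray_times_nth // ray_path_bend.
have sj : (s - j = (s - j.+1).+1)%N by lia.
rewrite !ray_exp ?ray_coef ?(ltnW js) // sj nth_mkseq //.
have [_ _ _ bne] := adm_bend Hd si.
split=> //.
- by rewrite xE; case: Qord => _ _; apply=> //; rewrite mem_head.
- by rewrite gt_eqF // coef_gt0.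
have [nJ uen _] := Hlev (s - j.+1)%N.
exists (kappa (s - j.+1)%N), [seq w <- en (s - j.+1)%N | inc (s - j.+1)%N w].
split=> //; first exact: filter_uniq.
by rewrite xE; exact: crossing_walls.
Qed.

End Generic.
End Ray.
End OneSide.
End Sides.

(** * Pairs of broken lines with a common endpoint *)

(** The pigeonhole principle: one of the finitely many patterns of truth values of
    the P t occurs arbitrarily close. *)
Lemma recurrent_pattern (R : realType) (X : Type) (small : R -> X -> Prop)
    (T : eqType) (P : T -> X -> Prop) (l : seq T) (good : X -> Prop) :
  (forall e e' x, e <= e' -> small e x -> small e' x) ->
  (forall e, 0 < e -> exists2 x, small e x & good x) ->
  exists b : pred T, forall e, 0 < e ->
    exists x, [/\ small e x, good x & forall t, t \in l -> b t = `[< P t x >]].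
Proof.
move=> mono; elim: l good => [|t l IHl] good acc.
  by exists predT => e /acc[x sx gx]; exists x.
have [v accv] : exists v : bool, forall e, 0 < e ->
    exists2 x, small e x & good x /\ v = `[< P t x >].
  apply: contrapT => /forallNP H.
  have [/existsNP[e1 /not_implyP[e10 /forall2NP e1P]]
        /existsNP[e2 /not_implyP[e20 /forall2NP e2P]]] := (H true, H false).
  have e0 : 0 < Num.min e1 e2 by rewrite lt_min e10.
  have [x sx gx] := acc _ e0.
  have [Px|nPx] := pselect (P t x).
    case: (e1P x) => [|]; first by apply; apply: mono sx; rewrite ge_min lexx.
    by apply; split=> //; apply/esym/asboolP.
  case: (e2P x) => [|]; first by apply; apply: mono sx; rewrite ge_min lexx orbT.
  by apply; split=> //; apply/esym/asboolPn.
have [b bP] := IHl _ accv.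
exists (fun x => if x == t then v else b x) => e /bP[x [sx [gx vx] bx]].
exists x; split=> // t'; rewrite inE; case: eqVneq => [-> _|_ /= t'l] //.
exact: bx.
Qed.

Section TwoSides.
Variables (R : realType) (S : seed) (C : set (MR R S)).
Hypothesis HC : monoid_cone C.
Variables (W : choiceType) (D : W -> wall R S) (c : W -> nat).
Hypothesis Dscat : scattering_diagram C D.
Hypothesis wserD : forall w, pos_upto (wser (D w)) (c w).
Hypothesis c_gt0 : forall w, (0 < c w)%N.

Let Dwall w : is_wall (D w). Proof. by case: Dscat. Qed.

Definition orderly (d : side S W) (Q : MR R S) : Prop :=
  exists2 e : R, 0 < e & forall Q', `|Q' - Q| < e -> ordered D d Q'.

(** The endpoints for which some line of the path meets a given subspace of
    codimension two lie in a hyperplane. *)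
Lemma generic_family (d : side S W) : admissible D c d ->
  exists (I : countType) (phi : I -> 'cV[R]_(rk S)),
    forall Q : MR R S, (forall i, phi i != 0 -> (Q *m phi i) 0 0 != 0) ->
    forall i t, (i <= sd_n d)%N ->
      ~ Sing D (line (sd_f d) (sd_nu d) i Q - t *: toR R (sd_f d i)).
Proof.
move=> Hd; set s := sd_n d; set f := sd_f d; set nu := sd_nu d.
have /choice[M MP] : forall i, exists M : 'M[R]_(rk S), (i <= s)%N ->
    M \in unitmx /\ forall Q, line f nu i Q = Q *m M.
  move=> i; have [si|si] := leqP i s; last by exists 0.
  have [|M Mu ME] := @line_mx R S f nu i; last by exists M.
  by move=> j ji; apply: (adm_flat Dscat Hd); exact: leq_trans si.
pose V i (a : sub_index (rk S)) : 'M[R]_(rk S) :=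
  cokermx (sub_space R a + toR R (f i))%MS.
exists (nat * sub_index (rk S) * 'I_(rk S))%type,
  (fun x => M x.1.1 *m col x.2 (V x.1.1 x.1.2)) => Q QP i t si.
move=> /(sing_sub Dwall)[a rka]; have [Mu ME] := MP i si; rewrite ME => suba.
have V0 : V i a != 0.
  rewrite -mxrank_eq0 mxrank_coker -lt0n subn_gt0.
  have := mxrank_adds_leqif (sub_space R a) (toR R (f i)) => -[le _].
  have := rank_leq_row (toR R (f i)); lia.
have [j jP] : exists j, col j (V i a) != 0.
  apply/existsP; apply: contra_neqT V0 => /existsPn H; apply/matrixP => k j.
  by have := H j; rewrite negbK => /eqP/colP/(_ k); rewrite !mxE.
have phi0 : M i *m col j (V i a) != 0.
  by apply: contra_neq jP => /(congr1 (mulmx (invmx (M i)))); rewrite mulKmx ?mulmx0.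
have /negP := QP (i, a, j) phi0; apply; rewrite /= mulmxA colE mulmxA.
rewrite (_ : Q *m M i *m V i a = 0) ?mul0mx ?mxE //.
apply/eqP; rewrite -submxE.
have -> : Q *m M i = (Q *m M i - t *: toR R (f i)) + t *: toR R (f i).
  by rewrite subrK.
apply: addmx_sub; first by apply: submx_trans suba _; exact: addsmxSl.
by apply: scalemx_sub; exact: addsmxSr.
Qed.

Lemma avoids_dense (d1 d2 : side S W) (Q : MR R S) (e : R) :
  admissible D c d1 -> admissible D c d2 -> 0 < e ->
  exists Q', [/\ `|Q' - Q| < e, avoids D d1 Q' & avoids D d2 Q'].
Proof.
move=> H1 H2 e0.
have [I1 [phi1 P1]] := generic_family H1.
have [I2 [phi2 P2]] := generic_family H2.
pose phi (i : I1 + I2 + 'rV[int]_(rk S)) := match i with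
  | inl (inl i) => phi1 i | inl (inr i) => phi2 i
  | inr v => ncol R (S := S) v end.
have [Q' Q'e QP] := @avoid_hyperplanes R (rk S) _ phi Q e e0.
have nSupp : ~ Supp D Q'.
  move=> [w _ wQ]; have [wN /(_ _ wQ) + _ _ _] := Dwall w.
  rewrite /perp /= pairRE => /eqP; apply/negP.
  apply: (QP (inr (wnormal (D w)))) => /=.
  by apply: contra_neq (Nplus_neq0 wN) => /ncol_eq0.
exists Q'; split=> //; split=> // i t si.
  by apply: P1 => // j; exact: (QP (inl (inl j))).
by apply: P2 => // j; exact: (QP (inl (inr j))).
Qed.

(** Endpoints close to Q0 whose paths have the same crossing coefficients give a
    sequence of generic broken lines. *)
Theorem pair_of_broken_lines (d1 d2 : side S W) (Q0 : MR R S) :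
  admissible D c d1 -> admissible D c d2 ->
  (forall e : R, 0 < e ->
     exists Q, [/\ `|Q - Q0| < e, orderly d1 Q & orderly d2 Q]) ->
  exists G1 G2 : bline R S W,
    [/\ [/\ broken_line C D G1, broken_line C D G2 & based G1 G2],
        bl_end G1 = Q0, bl_end G2 = Q0,
        bl_init G1 = sd_f d1 (sd_n d1) /\ bl_init G2 = sd_f d2 (sd_n d2) &
        bl_final G1 = sd_f d1 0 /\ bl_final G2 = sd_f d2 0].
Proof.
move=> H1 H2 near.
pose small (e : R) (Q : MR R S) := `|Q - Q0| < e.
have smallW e e' x : e <= e' -> small e x -> small e' x.
  by move=> ee xe; exact: lt_le_trans ee.
pose good Q := [/\ ordered D d1 Q, ordered D d2 Q, avoids D d1 Q & avoids D d2 Q].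
have acc0 (e : R) : 0 < e -> exists2 Q, small e Q & good Q.
  move=> e0; have e20 : 0 < e / 2 by rewrite divr_gt0.
  have [Q [Qe [e1 e10 o1] [e2 e20' o2]]] := near _ e20.
  have em0 : 0 < Num.min (e / 2) (Num.min e1 e2) by rewrite !lt_min e20 e10.
  have [Q' [+ a1 a2]] := avoids_dense Q H1 H2 em0.
  rewrite !lt_min => /and3P[Q'e Q'1 Q'2]; exists Q'; last first.
    by split=> //; [exact: o1 | exact: o2].
  rewrite /small -[Q'](subrK Q) -addrA (le_lt_trans (ler_normD _ _)) //.
  by rewrite [ltRHS]splitr ltrD.
have [k1 [en1 lev1]] := levels_exist HC Dscat d1.
have [k2 [en2 lev2]] := levels_exist HC Dscat d2.
pose inW (d : side S W) (x : nat * W) (Q : MR R S) :=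
  wsupp (D x.2) (bend (sd_f d) (sd_nu d) x.1 Q).
pose idx (d : side S W) (en : nat -> seq W) :=
  [seq (i, w) | i <- iota 0 (sd_n d), w <- en i].
have idxP d en i w : (i < sd_n d)%N -> w \in en i -> (i, w) \in idx d en.
  move=> id we; apply/allpairsPdep; exists i, w; split=> //.
  by rewrite mem_iota.
have [b1 acc1] := recurrent_pattern (inW d1) (idx d1 en1) smallW acc0.
pose good1 Q := good Q /\ forall x, x \in idx d1 en1 -> b1 x = `[< inW d1 x Q >].
have acc1' (e : R) : 0 < e -> exists2 Q, small e Q & good1 Q.
  by move=> /acc1[Q [? ? ?]]; exists Q.
have [b2 acc2] := recurrent_pattern (inW d2) (idx d2 en2) smallW acc1'.
have /choice[Qs QsP] : forall k : nat, exists Q,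
    [/\ small (k.+1%:R)^-1 Q, good1 Q &
        forall x, x \in idx d2 en2 -> b2 x = `[< inW d2 x Q >]].
  by move=> k; apply: acc2; rewrite invr_gt0 ltr0n.
have Qcvg : Qs @ \oo --> Q0.
  apply/cvgrPdist_lt => e e0; near=> k; rewrite distrC.
  have [Qk _ _] := QsP k; apply: lt_trans Qk _.
  near: k; exact: (near_infty_natSinv_lt (PosNum e0)).
have bl (d : side S W) kap en b : admissible D c d -> levels C D d kap en ->
    (forall k, [/\ ordered D d (Qs k), avoids D d (Qs k) &
       forall x, x \in idx d en -> b x = `[< inW d x (Qs k) >]]) ->
    let r := ray D d en (fun i w => b (i, w)) in
    broken_line C D (Bline (r Q0) (fun k => r (Qs k))) /\ dr_path (r Q0) 0 = Q0.
  move=> Hd lev Qgood r.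
  have Tcvg i : (i < sd_n d)%N ->
      time (sd_f d) (sd_nu d) i (Qs k) @[k --> \oo] -->
      time (sd_f d) (sd_nu d) i Q0.
    move=> id; apply: (cvg_comp _ _ Qcvg).
    by apply: (@time_continuous _ _ (sd_n d)) => // j; exact: (adm_flat Dscat Hd).
  have neg i : (i < sd_n d)%N -> time (sd_f d) (sd_nu d) i Q0 <= 0.
    move=> id; apply: (cvgr_to_le (Tcvg i id)).
    by near=> k; apply: ltW; have [[+ _ _] _ _] := Qgood k; exact.
  have decr i : (i.+1 < sd_n d)%N ->
      time (sd_f d) (sd_nu d) i.+1 Q0 <= time (sd_f d) (sd_nu d) i Q0.
    move=> id; apply: (ler_cvg_to (Tcvg _ id) (Tcvg _ (ltnW id))).
    by near=> k; apply: ltW; have [[_ + _] _ _] := Qgood k; exact.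
  split; last exact: ray_path_start.
  split=> /=.
  - exact: ray_linear.
  - move=> k; have [Qo Qa bP] := Qgood k.
    apply: (ray_generic HC Dscat wserD c_gt0 Hd lev Qo Qa) => i w id we.
    by apply: (bP (i, w)); exact: idxP.
  - by move=> k; split; rewrite ?size_mkseq.
  - move=> t t0; apply: (@pl_path_cvg R S (sd_n d) (sd_f d) nat \oo _ Qs
      (fun k => fun i => time (sd_f d) (sd_nu d) i (Qs k)) (fun=> t)) => //.
    exact: cvg_cst.
  - move=> j; have [jd|dj] := ltnP j (sd_n d).
      rewrite nth_mkseq // (_ : (fun k => _) =
        fun k => time (sd_f d) (sd_nu d) (sd_n d - j.+1) (Qs k)).
        by apply: Tcvg; lia.
      by apply/funext => k; rewrite nth_mkseq.
    rewrite nth_default ?size_mkseq // (_ : (fun k => _) = fun=> 0).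
      exact: cvg_cst.
    by apply/funext => k; rewrite nth_default ?size_mkseq.
have [B1 E1] := bl d1 k1 en1 b1 H1 lev1 (fun k =>
  let: And3 _ (conj (And4 o1 _ a1 _) b) _ := QsP k in And3 o1 a1 b).
have [B2 E2] := bl d2 k2 en2 b2 H2 lev2 (fun k =>
  let: And3 _ (conj (And4 _ o2 _ a2) _) b := QsP k in And3 o2 a2 b).
have start (d : side S W) en b k : admissible D c d ->
    ordered D d (Qs k) -> dr_path (ray D d en b (Qs k)) 0 = Qs k.
  by move=> Hd [neg _ _]; apply: ray_path_start => // i /neg/ltW.
eexists _, _; split.
- split; [exact: B1 | exact: B2 |] => k /=.
  have [_ [[Q1 Q2 _ _] _] _] := QsP k.
  have e1 := start d1 en1 (fun i w => b1 (i, w)) k H1 Q1.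
  exact: etrans e1 (esym (start d2 en2 (fun i w => b2 (i, w)) k H2 Q2)).
- exact: E1.
- exact: E2.
- by split; rewrite /bl_init ray_exp // subn0.
- by split; rewrite /bl_final size_mkseq ray_exp // subnn.
Unshelve. all: by end_near.
Qed.

End TwoSides.

(** * Deforming a segment into the two rays *)

Lemma uniform_small (R : realType) (X : Type) (small : R -> X -> Prop)
    (I : eqType) (l : seq I) (P : I -> X -> Prop) :
  (forall e e' x, e <= e' -> small e x -> small e' x) ->
  (forall i, i \in l -> exists2 e, 0 < e & forall x, small e x -> P i x) ->
  exists2 e, 0 < e & forall x, small e x -> forall i, i \in l -> P i x.
Proof.
move=> mono; elim: l => [|i l IHl] Hl; first by exists 1.
have [e e0 eP] := Hl i (mem_head _ _).
have [|e' e'0 e'P] := IHl; first by move=> j jl; apply: Hl; rewrite inE jl orbT.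
exists (Num.min e e'); first by rewrite lt_min e0.
move=> x sx j; rewrite inE => /orP[/eqP ->|jl].
  by apply: eP; apply: mono sx; rewrite ge_min lexx.
by apply: e'P => //; apply: mono sx; rewrite ge_min lexx orbT.
Qed.

Section Deform.
Variables (R : realType) (S : seed).
Variables (W : choiceType) (D : W -> wall R S) (c : W -> nat).
Variable (C : set (MR R S)).
Hypothesis Dscat : scattering_diagram C D.

Let Dwall w : is_wall (D w). Proof. by case: Dscat. Qed.

(** A point near the combination is again one, of a point of the wall close to x
    and a point close to z; walls are convex cones. *)
Lemma relint_comb (w : W) (x z : MR R S) (al ka : R) : 0 < al -> 0 < ka ->
  perp (wnormal (D w)) x -> relint (D w) z -> perp (wnormal (D w)) z ->
  (forall e : R, 0 < e -> exists2 x', wsupp (D w) x' & `|x' - x| < e) ->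
  relint (D w) (al *: x + ka *: z).
Proof.
move=> al0 ka0 px [e e0 eP] pz lim.
have [_ wp wc _ _] := Dwall w.
have [|x' wx' x'x] := lim (e * ka / (2 * al)).
  by rewrite divr_gt0 ?mulr_gt0.
exists (e * ka / 2); first by rewrite divr_gt0 ?mulr_gt0.
move=> y py yd.
pose z' := z + (al / ka) *: (x - x') + ka^-1 *: (y - (al *: x + ka *: z)).
have -> : y = al *: x' + ka *: z'.
  apply/rowP => j; rewrite /z' !mxE; field; exact: lt0r_neq0.
have px' := wp _ wx'.
apply: rational_coneD => //; first by apply: rational_coneZ => //; exact: ltW.
apply: rational_coneZ => //; first exact: ltW.
apply: eP.
  move: px pz px' py; rewrite /perp /= /z' => px pz px' py.
  by rewrite !(pairRD, pairRN, pairRZ) px pz px' py; ring.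
rewrite /z' -[z + _ + _]addrA addrAC subrr add0r (le_lt_trans (ler_normD _ _)) // !normrZ.
rewrite (gtr0_norm al0) gtr0_norm ?invr_gt0 //.
have h1 : al / ka * `|x - x'| < e / 2.
  have := x'x; rewrite distrC ltr_pdivlMr ?mulr_gt0 // => h.
  rewrite mulrAC ltr_pdivrMr //; lra.
have h2 : ka^-1 * `|y - (al *: x + ka *: z)| < e / 2.
  by rewrite mulrC ltr_pdivrMr //; lra.
lra.
Qed.

Variables (d : side S W) (Hd : admissible D c d).
Local Notation n := (sd_n d).
Local Notation f := (sd_f d).
Local Notation nu := (sd_nu d).

(** The data of one side of the segment: X are its bends at distances sg (in time)
    from its end, m its exponents, P its lines produced to time distance 0; the
    letters with a prime belong to a nearby generic segment of the same type. *)
Variables (a h tau : R) (m P P' X X' : nat -> MR R S) (sg sg' : nat -> R).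
Hypotheses (a0 : 0 < a) (h0 : 0 < h) (tau0 : 0 < tau).
Hypothesis fE : forall i, (i <= n)%N -> toR R (f i) = a *: P i.
Hypothesis XE : forall i, (i < n)%N ->
  X i = P i - sg i *: m i /\ X i = P i.+1 - sg i *: m i.+1.
Hypothesis X'E : forall i, (i < n)%N ->
  X' i = P' i - sg' i *: m i /\ X' i = P' i.+1 - sg' i *: m i.+1.
Hypothesis Xperp : forall i, (i < n)%N -> perp (nu i) (X i) /\ perp (nu i) (X' i).
Hypothesis sg_gt0 : forall i, (i < n)%N -> 0 < sg i.
Hypothesis sg_decr : forall i, (i.+1 < n)%N ->
  sg i.+1 <= sg i /\ sg' i.+1 < sg' i.
Hypothesis sg_tau : forall i, (i < n)%N -> sg i <= tau /\ (sg i < tau \/ sg' i < tau).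
Hypothesis Xwall : forall i w, (i < n)%N -> w \in sd_wl d i :: sd_cs d i ->
  relint (D w) (X' i) /\
  forall e : R, 0 < e -> exists2 x', wsupp (D w) x' & `|x' - X i| < e.

Definition deformed (ka : R) : MR R S :=
  h *: (P 0 - tau *: m 0) + ka *: (P' 0 - P 0).

Definition alpha (ka : R) i : R := (h * tau - ka * sg' i) / sg i.

(** The projective map that sends the point of a line [P - t m] at time t to its
    multiple by h tau / t turns the line into one of direction P. The nearby
    segment has other lines P', whereas the exponents of the path are fixed, so
    it can only enter to first order in ka; as the lines of the path are linear
    in its endpoint, the first order formula is exact. *)
Lemma deformed_line ka i : (i <= n)%N ->
  line f nu i (deformed ka) = (h - ka) *: P i + ka *: P' i - (h * tau) *: m i.
Proof.
suff H i' : (i' < n)%N ->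
    line f nu i' (deformed ka) =
      (h - ka) *: P i' + ka *: P' i' - (h * tau) *: m i' ->
    time f nu i' (deformed ka) = (h - ka - alpha ka i') / a.
  elim: i => [_|i IHi si].
    by rewrite /= /deformed; apply/rowP => j; rewrite !mxE; ring.
  have IH := IHi (ltnW si); rewrite lineS (H i) // IH toRB !fE //; last exact: ltnW.
  have [x1 x2] := XE si; have [y1 y2] := X'E si.
  have sg0 := sg_gt0 si.
  apply/rowP => j.
  have /rowP/(_ j) := etrans (esym x1) x2; have /rowP/(_ j) := etrans (esym y1) y2.
  rewrite !mxE => ey ex.
  have ae : (h * tau) = alpha ka i * sg i + ka * sg' i.
    by rewrite /alpha divfK ?gt_eqF // subrK.
  rewrite [in LHS]ae [in RHS]ae.
  have -> : (h - ka - alpha ka i) / a * (a * P i.+1 0 j - a * P i 0 j) =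
    (h - ka - alpha ka i) * (P i.+1 0 j - P i 0 j) by field; exact: lt0r_neq0.
  have e1 : P i 0 j = P i.+1 0 j - sg i * m i.+1 0 j + sg i * m i 0 j by lra.
  have e2 : P' i 0 j = P' i.+1 0 j - sg' i * m i.+1 0 j + sg' i * m i 0 j by lra.
  rewrite e1 e2; ring.
move=> si IH.
have [x1 _] := XE si; have [y1 _] := X'E si; have [p1 p2] := Xperp si.
have sg0 := sg_gt0 si.
have nz := adm_nz Hd si; have := nz; rewrite fE ?(ltnW si) // pairRZ => nz'.
rewrite /time IH fE ?(ltnW si) // pairRZ.
have e : (h - ka) *: P i' + ka *: P' i' - (h * tau) *: m i' =
  (h - ka - alpha ka i') *: P i' + (alpha ka i' *: X i' + ka *: X' i').
  apply/rowP => j; rewrite x1 y1 !mxE.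
  have ae : (h * tau) = alpha ka i' * sg i' + ka * sg' i'.
    by rewrite /alpha divfK ?gt_eqF // subrK.
  rewrite [in LHS]ae; ring.
move: p1 p2; rewrite /perp /= => p1 p2.
rewrite e !pairRD !pairRZ p1 p2 !mulr0 !addr0.
have Pn0 : pairR (nu i') (P i') != 0.
  by apply: contra_neq nz' => ->; rewrite mulr0.
by field; rewrite Pn0 lt0r_neq0.
Qed.

(** For small ka, both coefficients of the bend are positive. *)
Lemma deformed_time ka i : (i < n)%N ->
  time f nu i (deformed ka) = (h - ka - alpha ka i) / a /\
  bend f nu i (deformed ka) = alpha ka i *: X i + ka *: X' i.
Proof.
move=> si; have si' := ltnW si.
have [x1 _] := XE si; have [y1 _] := X'E si; have [p1 p2] := Xperp si.
have sg0 := sg_gt0 si.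
have nz := adm_nz Hd si; have := nz; rewrite fE // pairRZ => nz'.
have e : (h - ka) *: P i + ka *: P' i - (h * tau) *: m i =
  (h - ka - alpha ka i) *: P i + (alpha ka i *: X i + ka *: X' i).
  apply/rowP => j; rewrite x1 y1 !mxE.
  have ae : (h * tau) = alpha ka i * sg i + ka * sg' i.
    by rewrite /alpha divfK ?gt_eqF // subrK.
  rewrite [in LHS]ae; ring.
have te : time f nu i (deformed ka) = (h - ka - alpha ka i) / a.
  rewrite /time deformed_line // fE // pairRZ.
  move: p1 p2; rewrite /perp /= => p1 p2.
  rewrite e !pairRD !pairRZ p1 p2 !mulr0 !addr0.
  have Pn0 : pairR (nu i) (P i) != 0.
    by apply: contra_neq nz' => ->; rewrite mulr0.
  by field; rewrite Pn0 lt0r_neq0.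
split=> //; rewrite /bend te deformed_line // e fE // scalerA divfK ?gt_eqF //.
by rewrite addrC addrA addNr add0r.
Qed.

Lemma small_pos (A B : R) : 0 <= A -> 0 < A \/ 0 < B ->
  exists2 k0 : R, 0 < k0 & forall k, 0 < k < k0 -> 0 < A + k * B.
Proof.
move=> A0 AB; have [A1|A1] := ltP 0 A; last first.
  have A00 : A = 0 by apply/eqP; rewrite eq_le A0 A1.
  case: AB => [|B0]; first by rewrite A00 ltxx.
  by exists 1 => // k /andP[k0 _]; rewrite A00 add0r mulr_gt0.
have B1 : 0 < 1 + `|B| by rewrite ltr_pwDl.
exists (A / (1 + `|B|)); first by rewrite divr_gt0.
move=> k /andP[k0]; rewrite ltr_pdivlMr // => kA.
have : - `|B| <= B by rewrite lerNl -normrN ler_norm.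
move=> nB; have : k * - `|B| <= k * B by rewrite ler_pM2l.
by have := normr_ge0 B; nra.
Qed.

Theorem deformed_orderly : exists2 k0 : R, 0 < k0 &
  forall ka, 0 < ka < k0 -> orderly D d (deformed ka).
Proof.
pose small (e k : R) := is_true (0 < k < e).
have smallW e e' x : e <= e' -> small e x -> small e' x.
  by move=> ee /andP[x0 xe]; rewrite /small x0 (lt_le_trans xe).
have [k1 k10 k1P] : exists2 e, 0 < e & forall k, small e k ->
    forall i, i \in iota 0 n -> 0 < alpha k i /\ h - k - alpha k i < 0.
  apply: uniform_small => // i; rewrite mem_iota /= add0n => si.
  have sg0 := sg_gt0 si; have [st st'] := sg_tau si.
  have [||e1 e10 e1P] := @small_pos (h * tau) (- sg' i).
  - by rewrite ltW // mulr_gt0.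
  - by left; rewrite mulr_gt0.
  have [||e2 e20 e2P] := @small_pos (h * (tau - sg i)) (sg i - sg' i).
  - by rewrite mulr_ge0 ?subr_ge0 // ltW.
  - have [lt|eq] := ltP (sg i) tau; first by left; rewrite mulr_gt0 // subr_gt0.
    right; rewrite subr_gt0; case: st' => [|lt]; first by rewrite ltNge eq.
    exact: lt_le_trans eq.
  exists (Num.min e1 e2); first by rewrite lt_min e10.
  move=> k /andP[k0]; rewrite lt_min => /andP[ke1 ke2].
  have := e1P k; rewrite k0 ke1 => /(_ isT) h1.
  have := e2P k; rewrite k0 ke2 => /(_ isT) h2.
  split; first by rewrite /alpha divr_gt0 //; lra.
  rewrite -(pmulr_llt0 _ sg0) mulrBl /alpha divfK ?gt_eqF //; lra.
have [k2 k20 k2P] : exists2 e, 0 < e & forall k, small e k ->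
    forall i, i \in iota 0 n -> (i.+1 < n)%N -> alpha k i < alpha k i.+1.
  apply: uniform_small => // i _.
  have [si|] := ltnP i.+1 n; last by exists 1.
  have [ds ds'] := sg_decr si.
  have sg0 := sg_gt0 (ltnW si); have sg1 := sg_gt0 si.
  have [||e1 e10 e1P] := @small_pos (h * tau * (sg i - sg i.+1))
      (sg' i * sg i.+1 - sg' i.+1 * sg i).
  - by rewrite mulr_ge0 ?subr_ge0 // ltW // mulr_gt0.
  - have [lt|eq] := ltP (sg i.+1) (sg i).
      by left; rewrite mulr_gt0 ?subr_gt0 ?mulr_gt0.
    right; have -> : sg i.+1 = sg i by apply/eqP; rewrite eq_le ds.
    by rewrite -mulrBl mulr_gt0 // subr_gt0.
  exists e1 => // k /e1P h1 _.
  rewrite /alpha ltr_pdivrMr // mulrAC ltr_pdivlMr //; lra.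
exists (Num.min k1 k2); first by rewrite lt_min k10.
move=> ka /andP[ka0]; rewrite lt_min => /andP[ka1 ka2].
have {}k1P i : (i < n)%N -> 0 < alpha ka i /\ h - ka - alpha ka i < 0.
  by move=> si; apply: k1P; rewrite /small ?ka0 ?mem_iota.
have {}k2P i : (i.+1 < n)%N -> alpha ka i < alpha ka i.+1.
  by move=> si; apply: k2P; rewrite /small ?ka0 // mem_iota /= add0n ltnW.
set Q := deformed ka.
pose near (e : R) (Q' : MR R S) := is_true (`|Q' - Q| < e).
have nearW e e' x : e <= e' -> near e x -> near e' x.
  by move=> ee xe; rewrite /near (lt_le_trans xe).
have flat i : (i < n)%N ->
    pairR (nu i) (toR R (f i.+1)) = pairR (nu i) (toR R (f i)).
  exact: (adm_flat Dscat Hd).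
have cont i (e : R) : (i < n)%N -> 0 < e -> exists2 r : R, 0 < r &
    forall Q', near r Q' -> `|time f nu i Q' - time f nu i Q| < e /\
      `|bend f nu i Q' - bend f nu i Q| < e.
  move=> si e0.
  have /nbhs_rVP[r1 r10 r1P] : \forall Q' \near Q,
      `|time f nu i Q - time f nu i Q'| < e.
    have FF : Filter (nbhs Q) by exact: nbhs_filter.
    have /cvgrPdist_lt := @time_continuous _ _ _ _ _ flat i si Q; exact.
  have /nbhs_rVP[r2 r20 r2P] : \forall Q' \near Q,
      `|bend f nu i Q - bend f nu i Q'| < e.
    have FF : Filter (nbhs Q) by exact: nbhs_filter.
    have /cvgrPdist_lt := @bend_continuous _ _ _ _ _ flat i si Q; exact.
  exists (Num.min r1 r2); first by rewrite lt_min r10.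
  move=> Q'; rewrite /near lt_min => /andP[q1 q2].
  by rewrite distrC r1P // distrC r2P.
have [e1 e10 e1P] : exists2 e, 0 < e & forall Q', near e Q' ->
    forall i, i \in iota 0 n -> time f nu i Q' < 0.
  apply: uniform_small => // i; rewrite mem_iota /= add0n => si.
  have t0 : time f nu i Q < 0.
    have [-> _] := deformed_time ka si; have [_ lt0] := k1P i si.
    by rewrite pmulr_llt0 ?invr_gt0.
  have [|r r0 rP] := cont i (- time f nu i Q) si; first by rewrite oppr_gt0.
  by exists r => // Q' /rP[+ _]; rewrite ltr_norml; lra.
have [e2 e20 e2P] : exists2 e, 0 < e & forall Q', near e Q' ->
    forall i, i \in iota 0 n -> (i.+1 < n)%N -> time f nu i.+1 Q' < time f nu i Q'.
  apply: uniform_small => // i _.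
  have [si|] := ltnP i.+1 n; last by exists 1.
  have t0 : time f nu i.+1 Q < time f nu i Q.
    have [-> _] := deformed_time ka (ltnW si); have [-> _] := deformed_time ka si.
    have := k2P i si; rewrite ltr_pM2r ?invr_gt0 //; lra.
  pose g := (time f nu i Q - time f nu i.+1 Q) / 2.
  have g0 : 0 < g by rewrite divr_gt0 // subr_gt0.
  have [r r0 rP] := cont i g (ltnW si) g0.
  have [r' r'0 r'P] := cont i.+1 g si g0.
  exists (Num.min r r'); first by rewrite lt_min r0.
  move=> Q'; rewrite /near lt_min => /andP[/rP[+ _] /r'P[+ _]] _.
  by rewrite !ltr_norml /g; lra.
have [e3 e30 e3P] : exists2 e, 0 < e & forall Q', near e Q' ->
    forall i, i \in iota 0 n -> forall w, w \in sd_wl d i :: sd_cs d i ->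
      wsupp (D w) (bend f nu i Q').
  apply: uniform_small => // i; rewrite mem_iota /= add0n => si.
  apply: uniform_small => // w wi.
  have par := adm_par Hd si wi.
  have pp (x : MR R S) : perp (nu i) x -> perp (wnormal (D w)) x.
    by move=> px; apply/eqP; rewrite -(parallel_eq0 x par); apply/eqP.
  have [Xp X'p] := Xperp si; have [ri lim] := Xwall si wi.
  have [al0 _] := k1P i si.
  have [e e0 eP] := relint_comb al0 ka0 (pp _ Xp) ri (pp _ X'p) lim.
  have [r r0 rP] := cont i e si e0.
  exists r => // Q' /rP[_]; have [_ ->] := deformed_time ka si; apply: eP.
  by apply: pp; apply: bend_perp; exact: (adm_nz Hd).
exists (Num.min e1 (Num.min e2 e3)); first by rewrite !lt_min e10 e20.
move=> Q'; rewrite !lt_min => /and3P[q1 q2 q3].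
have iotaP i : (i < n)%N -> i \in iota 0 n by rewrite mem_iota.
split=> [i si|i si|i w si wi].
- by apply: e1P => //; exact: iotaP.
- by apply: e2P => //; apply: iotaP; exact: ltnW.
- by apply: (e3P Q' q3 i) => //; exact: iotaP.
Qed.

End Deform.

(** * The bends of a broken line and of its approximations *)

Lemma eventually_all (I : eqType) (l : seq I) (P : I -> nat -> Prop) :
  (forall i, i \in l -> exists K, forall k, (K <= k)%N -> P i k) ->
  exists K, forall k, (K <= k)%N -> forall i, i \in l -> P i k.
Proof.
elim: l => [|i l IHl] Hl; first by exists 0%N.
have [K KP] := Hl i (mem_head _ _).
have [|K' K'P] := IHl; first by move=> j jl; apply: Hl; rewrite inE jl orbT.
exists (maxn K K') => k; rewrite geq_max => /andP[Kk K'k] j.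
by rewrite inE => /orP[/eqP ->|jl]; [exact: KP | exact: K'P].
Qed.

Section Rays.
Variables (R : realType) (S : seed) (W : choiceType).

Definition bend_time (r : dray R S W) j : R := nth 0 (dr_times r) j.

(** Domain number j of the ray lies on the line [base r j - t m_j]. *)
Definition base (r : dray R S W) j : MR R S :=
  dr_path r (bend_time r j) + bend_time r j *: toR R (dr_exp r j).

Section Linear.
Variables (r : dray R S W) (Hr : linear_ray r).
Local Notation N := (size (dr_times r)).

Lemma bend_time_le0 j : bend_time r j <= 0.
Proof.
have [jN|Nj] := ltnP j N; last by rewrite /bend_time nth_default.
by case: Hr => _ _ _ /(all_nthP 0) /(_ j jN).
Qed.

Lemma bend_time_mono j : (j < N)%N -> bend_time r j <= bend_time r j.+1.
Proof.
move=> jN; have [j1|Nj] := ltnP j.+1 N.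
  by case: Hr => _ _ /(sortedP 0) /(_ j j1).
by rewrite [leRHS]/bend_time nth_default // bend_time_le0.
Qed.

Lemma path_in_domain j t : (j <= N)%N -> in_domain (dr_times r) j t ->
  dr_path r t = base r j - t *: toR R (dr_exp r j).
Proof.
move=> jN tj; case: Hr => _ _ _ _ lin.
have bj : in_domain (dr_times r) j (bend_time r j).
  split=> // j0; have := @bend_time_mono j.-1; rewrite prednK //; apply; lia.
rewrite /base -addrA -scalerBl -[LHS](subrK (dr_path r (bend_time r j))) addrC.
by rewrite (lin j) // opprB.
Qed.

Lemma bend_on_lines j : (j < N)%N ->
  dr_path r (bend_time r j) =
    base r j - bend_time r j *: toR R (dr_exp r j) /\
  dr_path r (bend_time r j) =
    base r j.+1 - bend_time r j *: toR R (dr_exp r j.+1).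
Proof.
move=> jN; split; first by rewrite /base addrK.
by apply: path_in_domain => //; split=> //=; exact: bend_time_mono.
Qed.

Lemma base_pred j : (j < N)%N ->
  base r j = base r j.+1 -
    bend_time r j *: (toR R (dr_exp r j.+1) - toR R (dr_exp r j)).
Proof.
move=> /bend_on_lines[e1 e2].
by rewrite scalerBr opprB addrCA -e2 e1 addrC subrK.
Qed.

End Linear.

Variables (C : set (MR R S)) (D : W -> wall R S).

(** Only points at fixed times and the times of the bends converge by definition.
    The last line is based at the endpoint; the others follow backwards, also
    those of domains that degenerate in the limit. *)
Lemma bline_cvg (G : bline R S W) j : broken_line C D G ->
  (j <= size (dr_times (bl_ray G)))%N ->
  (fun k => base (bl_seq G k) j) @ \oo --> base (bl_ray G) j.
Proof.
case=> lin gen same cpath ctime; set N := size _ => jN.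
have lin_k k : linear_ray (bl_seq G k) by case: (gen k).
have Nk k : size (dr_times (bl_seq G k)) = N by case: (same k).
have ek k i : dr_exp (bl_seq G k) i = dr_exp (bl_ray G) i.
  by rewrite /dr_exp; case: (same k) => _ ->.
rewrite -(subKn jN); elim: (N - j)%N (leq_subr j N) => {j jN} [_|i IHi iN].
  rewrite subn0 /base /bend_time nth_default // scale0r addr0.
  rewrite (_ : (fun k => _) = fun k => dr_path (bl_seq G k) 0); first exact: cpath.
  by apply/funext => k; rewrite nth_default ?Nk // scale0r addr0.
have NiN : (N - i.+1 < N)%N by lia.
have Ni : (N - i.+1).+1 = (N - i)%N by lia.
rewrite base_pred // Ni.
rewrite (_ : (fun k => _) = fun k => base (bl_seq G k) (N - i) -
    bend_time (bl_seq G k) (N - i.+1) *: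
      (toR R (dr_exp (bl_ray G) (N - i)) - toR R (dr_exp (bl_ray G) (N - i.+1)))).
  apply: cvgB; first by apply: IHi; exact: ltnW.
  by apply: cvgZr_tmp; exact: ctime.
by apply/funext => k; rewrite base_pred ?Nk // Ni !ek.
Qed.

Lemma bend_cvg (G : bline R S W) j : broken_line C D G ->
  (j < size (dr_times (bl_ray G)))%N ->
  (fun k => dr_path (bl_seq G k) (bend_time (bl_seq G k) j)) @ \oo -->
  dr_path (bl_ray G) (bend_time (bl_ray G) j).
Proof.
move=> HG jN; have := bline_cvg HG (ltnW jN).
case: HG => lin gen same cpath ctime.
have lin_k k : linear_ray (bl_seq G k) by case: (gen k).
have Nk k : size (dr_times (bl_seq G k)) = size (dr_times (bl_ray G)).
  by case: (same k).
move=> cb; have [-> _] := bend_on_lines lin jN.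
rewrite (_ : (fun k => _) = fun k => base (bl_seq G k) j -
    bend_time (bl_seq G k) j *: toR R (dr_exp (bl_ray G) j)).
  by apply: cvgB => //; apply: cvgZr_tmp; exact: ctime.
apply/funext => k; have jk : (j < size (dr_times (bl_seq G k)))%N by rewrite Nk.
have [-> _] := bend_on_lines (lin_k k) jk.
by rewrite /dr_exp; case: (same k) => _ -> _.
Qed.

Hypothesis HC : monoid_cone C.
Variable c : W -> nat.
Hypothesis Dscat : scattering_diagram C D.
Hypothesis wserD : forall w, pos_upto (wser (D w)) (c w).
Hypothesis c_gt0 : forall w, (0 < c w)%N.

Let Dwall w : is_wall (D w). Proof. by case: Dscat. Qed.

Lemma generic_bends (r : dray R S W) j (w0 : W) :
  generic_broken_line C D r -> (j < size (dr_times r))%N ->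
  let x := dr_path r (bend_time r j) in
  [/\ ~ Sing D x, wsupp (D (nth w0 (dr_walls r) j)) x &
    exists cs u, bends_by D c (dr_exp r j) (dr_exp r j.+1) cs u /\
      forall w, w \in cs -> wsupp (D w) x].
Proof.
move=> [lin [_ _ nsing _] _ _ bends] jN x.
have nsx : ~ Sing D x by apply: nsing; exact: bend_time_le0.
have [wx mne cne [k [sq [nJ usq sqP cE]]]] := bends j w0 jN.
split=> //.
have als : along D sq.
  move=> w w' /sqP[wx' _] /sqP[w'x _].
  apply: (@parallel_p1 R S); last by case: (Dwall w') => -[].
  exact: (nonsing_parallel Dwall nsx wx' w'x).
rewrite cE in cne.
have [u [ub mE]] := cross_walls_supp wserD usq als cne.
exists [seq w <- sq | (0 < u w)%N], u; split; last first.
  by move=> w; rewrite mem_filter => /andP[_ /sqP[]].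
split=> //; first exact: filter_uniq.
  by move=> w; rewrite mem_filter => /andP[-> /ub].
rewrite mE; congr (_ + _); rewrite big_filter [RHS]big_mkcond /=.
by apply: eq_bigr => w _; case: posnP => // ->; rewrite mulr0n.
Qed.

(** A wall that does not have the limit bend as a limit point is eventually
    avoided by the approximating bends. Only finitely many walls can contribute
    to a bend, so that one approximation serves for all of them. *)
Lemma good_index (G : bline R S W) (w0 : W) : broken_line C D G ->
  exists k, forall j, (j < size (dr_times (bl_ray G)))%N ->
    let r := bl_seq G k in
    exists cs u,
    bends_by D c (dr_exp r j) (dr_exp r j.+1) cs u /\
    forall w, w \in nth w0 (dr_walls r) j :: cs ->
      [/\ relint (D w) (dr_path r (bend_time r j)),
          parallel R (wnormal (D (nth w0 (dr_walls r) j))) (wnormal (D w)) &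
          forall e : R, 0 < e -> exists2 x', wsupp (D w) x' &
            `|x' - dr_path (bl_ray G) (bend_time (bl_ray G) j)| < e].
Proof.
move=> HG; have [lin gen same cpath ctime] := HG.
have Nk k : size (dr_times (bl_seq G k)) = size (dr_times (bl_ray G)).
  by case: (same k).
have ek k i : dr_exp (bl_seq G k) i = dr_exp (bl_ray G) i.
  by rewrite /dr_exp; case: (same k) => _ ->.
have wk k : dr_walls (bl_seq G k) = dr_walls (bl_ray G) by case: (same k).
pose lim (w : W) (j : nat) := forall e : R, 0 < e -> exists2 x', wsupp (D w) x' &
  `|x' - dr_path (bl_ray G) (bend_time (bl_ray G) j)| < e.
have [K KP] : exists K, forall k, (K <= k)%N ->
    forall j, j \in iota 0 (size (dr_times (bl_ray G))) ->
    exists cs u, bends_by D c (dr_exp (bl_ray G) j) (dr_exp (bl_ray G) j.+1) cs u /\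
      forall w, w \in nth w0 (dr_walls (bl_ray G)) j :: cs ->
        [/\ wsupp (D w) (dr_path (bl_seq G k) (bend_time (bl_seq G k) j)),
            ~ Sing D (dr_path (bl_seq G k) (bend_time (bl_seq G k) j)) & lim w j].
  apply: eventually_all => j; rewrite mem_iota /= add0n => jN.
  have [ka kaP] := Jpow_separated HC
    (dr_exp (bl_ray G) j.+1 - dr_exp (bl_ray G) j).
  have [_ /(_ ka)/finite_seqP[l lE]] := Dscat.
  have [K KP] : exists K, forall k, (K <= k)%N -> forall w,
      w \in nth w0 (dr_walls (bl_ray G)) j :: l ->
      wsupp (D w) (dr_path (bl_seq G k) (bend_time (bl_seq G k) j)) -> lim w j.
    apply: eventually_all => w _.
    have [//|/existsNP[e /not_implyP[e0 far]]] := pselect (lim w j).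
      by exists 0%N.
    have /cvgrPdist_lt/(_ e e0)[K _ KP] := bend_cvg HG jN.
    exists K => k Kk wx; exfalso; apply: far.
    exists (dr_path (bl_seq G k) (bend_time (bl_seq G k) j)) => //.
    by rewrite distrC; exact: KP.
  exists K => k Kk; have jNk : (j < size (dr_times (bl_seq G k)))%N by rewrite Nk.
  have [nsx wx [cs [u [bd csx]]]] := generic_bends w0 (gen k) jNk.
  rewrite !ek in bd; rewrite wk in wx.
  exists cs, u; split=> // w; rewrite inE => /orP[/eqP ->|wcs].
    by split=> //; apply: (KP k) => //; rewrite mem_head.
  split; [exact: csx | exact: nsx |].
  apply: (KP k) => //; last exact: csx.
  rewrite inE; apply/orP; right.
  have := bends_by_not_one_mod HC Dscat wserD c_gt0 bd wcs kaP.
  by have /seteqP[h _] := lE; move=> /h.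
exists K => j jN r; have [|cs [u [bd csP]]] := KP K (leqnn K) j.
  by rewrite mem_iota.
exists cs, u; rewrite /r !ek wk; split=> // w wcs.
have [wx nsx wl] := csP w wcs; have [w1x _ _] := csP _ (mem_head _ _).
split=> //; last exact: (nonsing_parallel Dwall nsx w1x wx).
by apply: not_wboundary_relint => // b; apply: nsx; left; exists w.
Qed.

End Rays.

(** * The data of a broken line segment *)

Section Segments.
Variables (R : realType) (S : seed) (C : set (MR R S)).
Hypothesis HC : monoid_cone C.
Variables (W : choiceType) (D : W -> wall R S) (c : W -> nat).
Hypothesis Dscat : scattering_diagram C D.
Hypothesis wserD : forall w, pos_upto (wser (D w)) (c w).
Hypothesis c_gt0 : forall w, (0 < c w)%N.

Let Dwall w : is_wall (D w). Proof. by case: Dscat. Qed.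

(** A segment with exponents m and bends at the times t, on the lines
    [L j - t m_j], together with a generic segment t', L' of the same type. *)
Record bent (s l : nat) (T tau : R) (t t' : nat -> R) (m : nat -> lattice S)
    (L L' : nat -> MR R S) (nrm : nat -> lattice S) (wl : nat -> W)
    (cs : nat -> seq W) (u : nat -> W -> nat) : Prop := Bent {
  bent_l : (l <= s)%N;
  bent_line : forall j, (j < s)%N ->
    L j - t j *: toR R (m j) = L j.+1 - t j *: toR R (m j.+1);
  bent_line' : forall j, (j < s)%N ->
    L' j - t' j *: toR R (m j) = L' j.+1 - t' j *: toR R (m j.+1);
  bent_Ncirc : forall j, (j < s)%N -> Ncirc (nrm j);
  bent_perp : forall j, (j < s)%N -> perp (nrm j) (L j - t j *: toR R (m j)) /\
    perp (nrm j) (L' j - t' j *: toR R (m j));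
  bent_range : forall j, (j < s)%N -> 0 <= t j <= T;
  bent_mono : forall j, (j.+1 < s)%N -> t j <= t j.+1 /\ t' j < t' j.+1;
  bent_before : forall j, (j < l)%N -> t j < tau;
  bent_after : forall j, (l <= j)%N -> (j < s)%N -> tau <= t j /\ tau < t' j;
  bent_by : forall j, (j < s)%N -> bends_by D c (m j) (m j.+1) (cs j) (u j);
  bent_wall : forall j w, (j < s)%N -> w \in wl j :: cs j ->
    [/\ parallel R (nrm j) (wnormal (D w)),
        relint (D w) (L' j - t' j *: toR R (m j)) &
        forall e : R, 0 < e -> exists2 x', wsupp (D w) x' &
          `|x' - (L j - t j *: toR R (m j))| < e] }.

(** The times of the generic segment are only relevant up to a common shift,
    which is chosen so that a bend at time tau occurs after it. *)
Lemma segment_bent (sg : segment R S W) (ns : seq (lattice S)) (tau : R) (w0 : W) :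
  broken_line_segment C D sg -> bend_normals D sg ns ->
  0 < tau < sg_len sg ->
  let s := size (sg_times sg) in
  let m j := nth 0 (sg_exps sg) j in
  exists t t' L L' wl cs u,
    bent s (bends_before sg tau) (sg_len sg) tau t t' m L L' (fun j => nth 0 ns j)
      wl cs u /\
    [/\ sg_path sg 0 = L 0%N,
        sg_path sg (sg_len sg) = L s - sg_len sg *: toR R (m s) &
        sg_path sg tau =
          L (bends_before sg tau) - tau *: toR R (m (bends_before sg tau))].
Proof.
move=> [G HG sgG] [ns_size nsP] /andP[tau0 tauT] s m.
have [k kP] := good_index HC Dscat wserD c_gt0 w0 HG.
have [lin gen same _ _] := HG.
move: sgG; rewrite /segment_of; set r := bl_ray G; set T := sg_len sg.
rewrite -/s => -[t0 [p [[T0 tT psN] pathE [before inside after] timesE [expsE wallsE]]]].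
set r' := bl_seq G k.
have lin' : linear_ray r' by case: (gen k).
have [N' monos' walls'] := same k; rewrite -/r' -/r in N' monos' walls'.
have e' j : dr_exp r' j = dr_exp r j by rewrite /dr_exp monos'.
have sz : s = size (take s (drop p (dr_times r))).
  by rewrite -(size_map (fun t => t - t0)) -timesE.
have pjN j : (j < s)%N -> (p + j < size (dr_times r))%N.
  by move=> js; apply: leq_trans psN; rewrite ltn_add2l.
have times_j j : (j < s)%N -> nth 0 (sg_times sg) j = bend_time r (p + j) - t0.
  move=> js; rewrite timesE (nth_map 0) ?nth_take ?nth_drop //.
  by rewrite -sz.
have exps_j j : (j <= s)%N -> m j = dr_exp r (p + j).
  move=> js; have [Nm _ _ _ _] := lin.
  rewrite /m expsE (nth_map (0, 0)) ?nth_take ?nth_drop // size_takel //.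
  by rewrite size_drop Nm subSn ?ltnS ?leq_subRL //; apply: leq_trans psN; rewrite leq_addr.
have walls_j j : (j < s)%N -> nth w0 (sg_walls sg) j = nth w0 (dr_walls r) (p + j).
  by move=> js; rewrite wallsE nth_take ?nth_drop.
have in_j j : (j < s)%N -> t0 <= bend_time r (p + j) <= t0 + T.
  move=> js; move: inside => /(all_nthP 0)/(_ j).
  by rewrite nth_take ?nth_drop //; apply; rewrite -sz.
have before_p : (0 < p)%N -> bend_time r p.-1 <= t0.
  move=> p0; move: before => /(all_nthP 0)/(_ p.-1).
  rewrite nth_take ?prednK //; apply; rewrite size_takel ?prednK //.
  by apply: leq_trans psN; rewrite leq_addr.
have after_s : t0 + T <= bend_time r (p + s).
  have [psN'|] := ltnP (p + s) (size (dr_times r)); last by move=> ?; rewrite /bend_time nth_default.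
  move: after => /(all_nthP 0)/(_ 0%N); rewrite size_drop nth_drop addn0.
  by apply; rewrite subn_gt0.
set l := bends_before sg tau.
have sorted_sg : sorted <=%R (sg_times sg).
  apply/(sortedP 0) => j js; rewrite !times_j ?(ltnW js) // lerD2r addnS.
  by apply: bend_time_mono => //; apply: pjN; exact: ltnW.
have ls : (l <= s)%N by exact: count_size.
have before_l j : (j < l)%N -> bend_time r (p + j) - t0 < tau.
  move=> jl; rewrite -times_j ?(leq_trans jl) //.
  exact: (@nth_count_lt _ _ tau 0 (sg_times sg)).
have after_l j : (l <= j)%N -> (j < s)%N -> tau <= bend_time r (p + j) - t0.
  move=> lj js; rewrite -times_j //; apply: nth_count_ge => //.
  by rewrite js andbT.
have mono' i j : (i <= j)%N -> (j < s)%N ->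
    bend_time r' (p + i) <= bend_time r' (p + j).
  elim: j => [|j IHj]; first by rewrite leqn0 => /eqP ->.
  rewrite leq_eqVlt => /orP[/eqP -> //|ij] js.
  apply: le_trans (IHj ij (ltnW js)) _; rewrite addnS.
  by apply: bend_time_mono => //; rewrite N'; apply: pjN; exact: ltnW.
pose sh := 1 + tau - (bend_time r' (p + l) - t0).
pose L j := base r (p + j) - t0 *: toR R (dr_exp r (p + j)).
pose L' j := base r' (p + j) - (t0 - sh) *: toR R (dr_exp r (p + j)).
pose t j := bend_time r (p + j) - t0.
pose t' j := bend_time r' (p + j) - t0 + sh.
have XE j : (j < s)%N ->
    L j - t j *: toR R (m j) = dr_path r (bend_time r (p + j)) /\
    L j.+1 - t j *: toR R (m j.+1) = dr_path r (bend_time r (p + j)).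
  move=> js; have jN : (p + j < size (dr_times r))%N by exact: pjN.
  have [e1 e2] := bend_on_lines lin jN.
  split; [rewrite e1 | rewrite e2]; rewrite /L /t exps_j ?(ltnW js) //.
    by apply/rowP => i; rewrite !mxE; ring.
  by rewrite addnS; apply/rowP => i; rewrite !mxE; ring.
have X'E j : (j < s)%N ->
    L' j - t' j *: toR R (m j) = dr_path r' (bend_time r' (p + j)) /\
    L' j.+1 - t' j *: toR R (m j.+1) = dr_path r' (bend_time r' (p + j)).
  move=> js; have jN : (p + j < size (dr_times r'))%N by rewrite N'; exact: pjN.
  have [e1 e2] := bend_on_lines lin' jN.
  split; [rewrite e1 | rewrite e2]; rewrite /L' /t' exps_j ?(ltnW js) // e'.
    by apply/rowP => i; rewrite !mxE; ring.
  by rewrite addnS; apply/rowP => i; rewrite !mxE; ring.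
have good j : (j < s)%N -> exists csu : seq W * (W -> nat),
    bends_by D c (m j) (m j.+1) csu.1 csu.2 /\
    forall w, w \in nth w0 (dr_walls r) (p + j) :: csu.1 ->
    [/\ relint (D w) (dr_path r' (bend_time r' (p + j))),
        parallel R (wnormal (D (nth w0 (dr_walls r) (p + j)))) (wnormal (D w)) &
        forall e : R, 0 < e -> exists2 x', wsupp (D w) x' &
            `|x' - dr_path r (bend_time r (p + j))| < e].
  move=> js; have jN : (p + j < size (dr_times r))%N by exact: pjN.
  have [cs [u [bd csP]]] := kP (p + j)%N jN.
  rewrite -/r' !e' walls' -addnS -!exps_j // in bd csP; last exact: ltnW.
  by exists (cs, u).
have /choice[csu csuP] : forall j, exists csu : seq W * (W -> nat), (j < s)%N ->
    bends_by D c (m j) (m j.+1) csu.1 csu.2 /\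
    forall w, w \in nth w0 (dr_walls r) (p + j) :: csu.1 ->
    [/\ relint (D w) (dr_path r' (bend_time r' (p + j))),
        parallel R (wnormal (D (nth w0 (dr_walls r) (p + j)))) (wnormal (D w)) &
        forall e : R, 0 < e -> exists2 x', wsupp (D w) x' &
            `|x' - dr_path r (bend_time r (p + j))| < e].
  move=> j; have [js|] := ltnP j s; last by exists ([::], fun=> 0%N).
  by have [x xP] := good j js; exists x.
have s_ns : size ns = s.
  rewrite ns_size wallsE size_take size_drop.
  by have [_ -> _ _ _] := lin; rewrite -/r; case: ifP; lia.
have nsW j : (j < s)%N -> primitive (nth 0 ns j) /\
    wsupp (D (nth w0 (dr_walls r) (p + j))) `<=` perp (nth 0 ns j).
  by move=> js; rewrite -walls_j //; apply: nsP; rewrite s_ns.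
have nspar j : (j < s)%N ->
    parallel R (nth 0 ns j) (wnormal (D (nth w0 (dr_walls r) (p + j)))).
  move=> js; have [/primitive_neq0 n0 wp] := nsW j js.
  exact: (wall_normal_unique Dwall).
exists t, t', L, L', (fun j => nth w0 (dr_walls r) (p + j)),
  (fun j => (csu j).1), (fun j => (csu j).2).
split; first split=> //.
- by move=> j /XE[-> ->].
- by move=> j /X'E[-> ->].
- by move=> j /nsW[[]].
- move=> j js; have [-> _] := XE j js; have [-> _] := X'E j js.
  have [_ wp] := nsW j js; have [_ /(_ _ (mem_head _ _))[_ _ lim]] := csuP j js.
  split; last first.
    have jN : (p + j < size (dr_times r'))%N by rewrite N'; exact: pjN.
    have [_ wx _] := generic_bends Dscat wserD w0 (gen k) jN.
    by apply: wp; rewrite -/r' walls' in wx.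
  apply: contrapT => /eqP nX.
  have /cvgrPdist_lt/(_ `|pairR (nth 0 ns j) (dr_path r (bend_time r (p + j)))|) :=
    @pairR_continuous R S (nth 0 ns j) (dr_path r (bend_time r (p + j))).
  rewrite normr_gt0 => /(_ nX)/nbhs_rVP[e e0 eP].
  have [x' /wp px' x'e] := lim e e0; have := eP _ x'e.
  by move: px'; rewrite /perp /= => ->; rewrite subr0 ltxx.
- move=> j js; have := in_j j js; rewrite /t; lra.
- move=> j js; rewrite /t /t' addnS; split.
    by rewrite lerD2r; apply: bend_time_mono => //; apply: pjN; exact: ltnW.
  rewrite ltrD2r ltrD2r.
  have [_ _ [st _] _ _] := gen k.
  by move: st => /(sortedP 0); apply; rewrite -/r' N' -addnS; exact: pjN.
- move=> j lj js; split; first exact: after_l.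
  rewrite /t' /sh; have := mono' l j lj js; lra.
- by move=> j /csuP[].
- move=> j w js wcs; have [-> _] := XE j js; have [-> _] := X'E j js.
  have [_ /(_ w wcs)[ri par lim]] := csuP j js; split=> //.
  exact: parallel_trans (nspar j js) par.
have dom0 j v : (j <= s)%N -> ((0 < j)%N -> bend_time r (p + j.-1) <= t0 + v) ->
    ((j < s)%N -> t0 + v <= bend_time r (p + j)) -> 0 <= v <= T ->
    sg_path sg v = L j - v *: toR R (m j).
  move=> js lo hi /andP[v0 vT].
  rewrite pathE ?v0 // (@path_in_domain _ _ _ _ lin (p + j)).
  - rewrite /L exps_j //; apply/rowP => i; rewrite !mxE; ring.
  - by apply: leq_trans psN; rewrite leq_add2l.
  split=> [pj|]; last first.
    have [/hi //|sj] := ltnP j s; have -> : j = s by apply/eqP; rewrite eqn_leq js.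
    by apply: le_trans after_s; rewrite lerD2l.
  case: j js lo {hi} pj => [|j] js lo pj; last by rewrite addnS; apply: lo.
  rewrite addn0 in pj *; apply: le_trans (before_p pj) _.
  by rewrite lerDl.
split.
- rewrite (dom0 0%N) ?scale0r ?subr0 // ?lexx ?addr0 // => s0.
  by have /andP[] := in_j _ s0.
- apply: (dom0 s T); [by [] | | by rewrite ltnn | by rewrite lexx T0].
  by move=> s0; have := in_j s.-1; rewrite prednK // => /(_ (leqnn _))/andP[].
- apply: (dom0 l tau); [by [] | | | by rewrite !ltW].
    by move=> l0; have := before_l l.-1; rewrite prednK // => /(_ (leqnn _)); lra.
  by move=> ls'; have := after_l l (leqnn _) ls'; lra.
Qed.

End Segments.

(** * The two halves of a segment *)

Section Halves.
Variables (R : realType) (S : seed) (C : set (MR R S)).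
Variables (W : choiceType) (D : W -> wall R S) (c : W -> nat).
Hypothesis Dscat : scattering_diagram C D.

Let wNuf w : Nuf_of (uf S) (wnormal (D w)).
Proof. by case: Dscat => /(_ w)[[]]. Qed.

Lemma cross_expE (w : W) (m : lattice S) :
  (cross_exp (D w) m)%:R = `|pairR (ray_gen R (wnormal (D w))) (toR R m)|.
Proof.
rewrite (pairR_toR _ _ (@ray_gen_Ncirc R S _)) -(intr_norm R) /cross_exp.
by rewrite natr_absz.
Qed.

Lemma cross_exp_scale (w : W) (m g : lattice S) (k : nat) :
  pairR (wnormal (D w)) (toR R g) = k%:R * pairR (wnormal (D w)) (toR R m) ->
  cross_exp (D w) g = (k * cross_exp (D w) m)%N.
Proof.
move=> e; have [r _ rE] := @ray_gen_prop R S (wnormal (D w)).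
apply/eqP; rewrite -(eqr_nat R) natrM !cross_expE !rE e mulrCA normrM.
by rewrite normr_nat.
Qed.

Lemma bends_by_pair m m' cs u w : bends_by D c m m' cs u ->
  (forall w', w' \in cs -> parallel R (wnormal (D w)) (wnormal (D w'))) ->
  pairR (wnormal (D w)) (toR R m') = pairR (wnormal (D w)) (toR R m).
Proof.
move=> [_ _ -> _] par; rewrite toRD pairRD toR_sum pairR_sum big_seq.
rewrite big1 ?addr0 // => w' w'cs.
by rewrite toRMn pairRZ (parallel_p1 (par w' w'cs)) ?mulr0.
Qed.

(** A bend needs a positive exponent of the wall function. *)
Lemma bends_by_transverse m m' cs u v : bends_by D c m m' cs u ->
  (forall w, w \in cs -> parallel R v (wnormal (D w))) ->
  pairR v (toR R m) != 0.
Proof.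
case: cs => [|w cs] [_ ub m'E mm'] par.
  by move: mm'; rewrite m'E big_nil addr0 eqxx.
have wcs : w \in w :: cs by rewrite mem_head.
rewrite (parallel_eq0 _ (par w wcs)).
have /andP[u0 ule] := ub w wcs.
have : (0 < cross_exp (D w) m)%N.
  by have := leq_trans u0 ule; rewrite muln_gt0 => /andP[].
rewrite lt0n; apply: contra_neq => n0; apply/eqP; rewrite -(eqr_nat R) cross_expE.
have [r _ ->] := @ray_gen_prop R S (wnormal (D w)).
by rewrite n0 mulr0 normr0.
Qed.

(** Multiplying a bend by a positive integer, at an exponent that pairs with the
    walls like the corresponding multiple: the wall function is raised to the
    multiple power, so that it contains the multiple term. *)
Lemma bends_by_scale m m' g g' cs u (k : nat) : (0 < k)%N ->
  bends_by D c m m' cs u -> g' - g = (m' - m) *+ k ->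
  (forall w, w \in cs ->
     pairR (wnormal (D w)) (toR R g) = k%:R * pairR (wnormal (D w)) (toR R m)) ->
  bends_by D c g g' cs (fun w => k * u w)%N.
Proof.
move=> k0 [ucs ub m'E mm'] gE gp; split=> //.
- move=> w wcs; have /andP[u0 ule] := ub w wcs.
  rewrite muln_gt0 k0 u0 /= (cross_exp_scale (gp w wcs)) -mulnA.
  by rewrite leq_mul2l ule orbT.
- rewrite -[g'](subrK g) addrC; congr (_ + _).
  rewrite gE m'E addrC addKr -sumrMnl; apply: eq_bigr => w _.
  by rewrite mulnC mulrnA.
- rewrite -subr_eq0 gE; move: mm'; rewrite -subr_eq0; apply: contra_neq => e.
  have /eqP := congr1 (@toR R S) e; rewrite toRMn toR0 scaler_eq0 pnatr_eq0.
  rewrite -leqn0 leqNgt k0 /= => /eqP e0.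
  by apply: (@toR_inj R S); rewrite e0 toR0.
Qed.

(** A segment run backwards bends at the same walls, as the exponents of the wall
    functions are the same on both sides of a bend. *)
Lemma bends_by_reverse m m' cs u v : bends_by D c m m' cs u ->
  (forall w, w \in cs -> parallel R v (wnormal (D w))) ->
  bends_by D c (- m') (- m) cs u.
Proof.
move=> bd par; have [ucs ub m'E mm'] := bd; split=> //.
- move=> w wcs; suff -> : cross_exp (D w) (- m') = cross_exp (D w) m by exact: ub.
  have e : pairR (wnormal (D w)) (toR R m') = pairR (wnormal (D w)) (toR R m).
    apply: bends_by_pair bd _ => w' w'cs.
    exact: parallel_trans (parallel_sym (par w wcs)) (par w' w'cs).
  have [r _ rE] := @ray_gen_prop R S (wnormal (D w)).
  by apply/eqP; rewrite -(eqr_nat R) !cross_expE !rE toRN pairRN e mulrN normrN.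
- by rewrite m'E opprD subrK.
- by rewrite eqr_opp eq_sym.
Qed.

(** The exponents a P i are integral, by induction from the end of the segment:
    crossing the bend i changes a P i by the multiple a sg i of the change of M,
    and orthogonality of the bend to nrm i computes this multiple. *)
Lemma side_of_half (n0 : nat) (a : nat) (sg : nat -> R) (M : nat -> lattice S)
    (P : nat -> MR R S) (nrm : nat -> lattice S) (wl : nat -> W)
    (cs : nat -> seq W) (u : nat -> W -> nat) (v : lattice S) :
  (0 < a)%N ->
  (forall i, (i < n0)%N -> 0 <= sg i) ->
  (forall i, (i.+1 < n0)%N -> sg i.+1 <= sg i) ->
  (forall i, (i < n0)%N ->
     P i - sg i *: toR R (M i) = P i.+1 - sg i *: toR R (M i.+1)) ->
  (forall i, (i < n0)%N -> Ncirc (nrm i)) ->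
  (forall i, (i < n0)%N -> perp (nrm i) (P i - sg i *: toR R (M i))) ->
  (forall i, (i < n0)%N -> bends_by D c (M i.+1) (M i) (cs i) (u i)) ->
  (forall i w, (i < n0)%N -> w \in wl i :: cs i ->
     parallel R (nrm i) (wnormal (D w))) ->
  a%:R *: P n0 = toR R ((\prod_(i < n0) pairZ (nrm i) (M i.+1)) *: v) ->
  P n0 != 0 ->
  exists d : side S W,
    [/\ [/\ admissible D c d, (sd_n d <= n0)%N & P (sd_n d) = P n0],
        [/\ sd_nu d = nrm, sd_wl d = wl & sd_cs d = cs],
        forall i, (i <= n0)%N -> toR R (sd_f d i) = a%:R *: P i &
        forall i, (i < sd_n d)%N -> 0 < sg i].
Proof.
move=> a0 sg0 sgd PE nrmN perpX bd par Pn0 Pn00.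
have a0' : a%:R != 0 :> R by rewrite pnatr_eq0 -lt0n.
have par' i w : (i < n0)%N -> w \in cs i -> parallel R (nrm i) (wnormal (D w)).
  by move=> iN wcs; apply: par => //; rewrite inE wcs orbT.
have tr i : (i < n0)%N -> pairR (nrm i) (toR R (M i.+1)) != 0.
  by move=> iN; apply: bends_by_transverse (bd i iN) _ => w; exact: par'.
have step i : (i < n0)%N ->
    P i = P i.+1 + sg i *: (toR R (M i) - toR R (M i.+1)).
  move=> iN; rewrite scalerBr addrCA -PE // addrC.
  by rewrite subrK.
have perpX' i : (i < n0)%N ->
    pairR (nrm i) (P i.+1) = sg i * pairR (nrm i) (toR R (M i.+1)).
  move=> iN; have := perpX i iN; rewrite PE // /perp /= pairRB pairRZ.
  by move/eqP; rewrite subr_eq0 => /eqP.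
have int_step i (w : lattice S) : (i < n0)%N ->
    a%:R *: P i.+1 = toR R ((\prod_(j < i.+1) pairZ (nrm j) (M j.+1)) *: w) ->
    a%:R * sg i = (\prod_(j < i) pairZ (nrm j) (M j.+1) * pairZ (nrm i) w)%:~R.
  move=> iN e; have := congr1 (pairR (nrm i)) e.
  rewrite pairRZ perpX' // toRZ pairRZ (pairR_toR _ _ (nrmN i iN)).
  rewrite (pairR_toR _ _ (nrmN i iN)) big_ord_recr /= => e'.
  have := tr i iN; rewrite (pairR_toR _ _ (nrmN i iN)) => pi0.
  apply: (mulIf pi0); rewrite -mulrA e' !rmorphM /=; ring.
have intk k : (k <= n0)%N -> exists w : lattice S, a%:R *: P (n0 - k)%N =
    toR R ((\prod_(j < n0 - k) pairZ (nrm j) (M j.+1)) *: w).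
  elim: k => [_|k IHk kn]; first by exists v; rewrite subn0.
  have [w wE] := IHk (ltnW kn); set i := (n0 - k.+1)%N.
  have ei : (n0 - k = i.+1)%N by rewrite /i; lia.
  have iN : (i < n0)%N by rewrite /i; lia.
  rewrite ei in wE; have e := int_step i w iN wE.
  exists (pairZ (nrm i) (M i.+1) *: w + pairZ (nrm i) w *: (M i - M i.+1)).
  rewrite step // scalerDr wE scalerA e -toRB -toRZ -toRD big_ord_recr /=.
  by rewrite [in RHS]scalerDr !scalerA.
have intP i : exists g : lattice S, (i <= n0)%N -> toR R g = a%:R *: P i.
  have [iN|] := leqP i n0; last by exists 0.
  have [|w wE] := intk (n0 - i)%N; first exact: leq_subr.
  by eexists => _; rewrite subKn // in wE; rewrite wE.
have /choice[f fE] := intP.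
have intS i : exists k : nat, (i < n0)%N -> k%:R = a%:R * sg i.
  have [iN|] := ltnP i n0; last by exists 0%N.
  have [|w wE] := intk (n0 - i.+1)%N; first exact: leq_subr.
  rewrite subKn // in wE; have e := int_step i w iN wE.
  have [z zE] : exists z : int, z%:~R = a%:R * sg i by eexists; rewrite e.
  exists `|z|%N => _; rewrite natr_absz intr_norm zE ger0_norm //.
  by rewrite mulr_ge0 // sg0.
have /choice[lam lamE] := intS.
have [n [nn0 npos nzero]] : exists n, [/\ (n <= n0)%N,
    forall i, (i < n)%N -> 0 < sg i &
    forall i, (n <= i)%N -> (i < n0)%N -> sg i = 0].
  clear -sg0 sgd; elim: n0 sg0 sgd => [|k IHk] sg0 sgd.
    by exists 0%N; split.
  have [||n [nk npos nzero]] := IHk.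
  - by move=> i ik; apply: sg0; exact: ltnW.
  - by move=> i ik; apply: sgd; exact: ltnW.
  have [sgk|sgk] := ltP 0 (sg k).
    exists k.+1; split=> // [i|i]; last by move=> h1 h2; lia.
    rewrite ltnS leq_eqVlt => /orP[/eqP ->//|ik].
    apply: lt_le_trans sgk _.
    exact: (@weak_decr R k.+1 sg sgd i k (ltnW ik) (ltnSn k)).
  exists n; split=> //; first exact: leqW.
  move=> i ni; rewrite ltnS leq_eqVlt => /orP[/eqP ->|ik]; last exact: nzero.
  by apply/eqP; rewrite eq_le sgk sg0.
have Pn : P n = P n0.
  suff H k : (n + k <= n0)%N -> P (n + k)%N = P n by rewrite -(H (n0 - n)%N) subnKC.
  elim: k => [|k IHk] nk; first by rewrite addn0.
  have iN : (n + k < n0)%N by rewrite -addnS.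
  rewrite -IHk; last exact: ltnW.
  by rewrite (step _ iN) nzero ?leq_addr // scale0r addr0 addnS.
exists (Side n f nrm wl cs (fun i w => lam i * u i w)%N); split=> //=.
split=> //; split=> /=.
- move=> i iN; have iN0 := leq_trans iN nn0.
  rewrite fE ?(ltnW iN0) // pairRZ step // pairRD perpX' // pairRZ -toRB.
  rewrite toRB pairRB -mulrDr addrC subrK mulf_neq0 // mulf_neq0 //.
    by rewrite gt_eqF // npos.
  have [w wcs] : exists w, w \in cs i.
    have [_ _ e ne] := bd i iN0; case E : (cs i) => [|w l]; last first.
      by exists w; rewrite mem_head.
    by move: ne; rewrite e E big_nil addr0 eqxx.
  rewrite (parallel_eq0 _ (par' i w iN0 wcs)).
  rewrite (bends_by_pair (bd i iN0)); last first.
    move=> w' w'cs.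
    exact: parallel_trans (parallel_sym (par' i w iN0 wcs)) (par' i w' iN0 w'cs).
  by rewrite -(parallel_eq0 _ (par' i w iN0 wcs)) tr.
- move=> i iN; have iN0 := leq_trans iN nn0.
  apply: bends_by_scale (bd i iN0) _ _.
  + by rewrite -(ltr0n R) lamE // mulr_gt0 ?npos // ltr0n.
  + apply: (@toR_inj R S); rewrite toRB !fE ?(ltnW iN0) // toRMn lamE // step //.
    by rewrite toRB scalerDr addrC addKr scalerA.
  + move=> w wcs; rewrite fE // lamE // pairRZ -!mulrA; congr (_ * _).
    have := perpX i iN0; rewrite PE // /perp /= => /eqP.
    rewrite (parallel_eq0 _ (par' i w iN0 wcs)) pairRB pairRZ subr_eq0.
    by move/eqP.
- by move=> i w iN; apply: par; exact: leq_trans nn0.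
- apply: contra_neq Pn00 => fn0; have := fE n nn0; rewrite fn0 toR0 Pn => /esym/eqP.
  by rewrite scaler_eq0 (negbTE a0') => /eqP.
Qed.

End Halves.

(** * The balanced pair *)

Theorem proposition5p4 (R : realType) (S : seed) (C : set (MR R S))
    (HC : monoid_cone C) (W : choiceType) (D : W -> wall R S)
    (HD : cluster_scattering_diagram C D)
    (sg : segment R S W) (Hsg : broken_line_segment C D sg)
    (ns : seq (lattice S)) (Hns : bend_normals D sg ns)
    (Hp : rational_point (sg_path sg 0))
    (Hq : rational_point (sg_path sg (sg_len sg)))
    (Hp0 : sg_path sg 0 <> 0) (Hq0 : sg_path sg (sg_len sg) <> 0)
    (tau : rat) (Htau : 0 < (ratr tau : R) < sg_len sg)
    (Hx : rational_point (sg_path sg (ratr tau)))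
    (a b : nat) (Ha : (0 < a)%N) (Hb : (0 < b)%N)
    (Hab : b%:R / (a + b)%N%:R = ratr tau / sg_len sg)
    (Hrho1 : in_multiple (rho1 sg ns (ratr tau)) (a%:R *: sg_path sg 0))
    (Hrho2 : in_multiple (rho2 sg ns (ratr tau))
                         (b%:R *: sg_path sg (sg_len sg))) :
  exists G1 G2 : bline R S W,
    [/\ broken_line C D G1, broken_line C D G2,
        balanced G1 G2 ((a + b)%N%:R *: sg_path sg (ratr tau)),
        toR R (bl_init G1) = a%:R *: sg_path sg 0 &
        toR R (bl_init G2) = b%:R *: sg_path sg (sg_len sg)].
Proof.
have [Dscat _ [init _] wserE] := HD.
have [i0 _] : exists i0 : 'I_(rk S), true.
  apply: contrapT => /forallNP no; apply: Hp0; apply/rowP => i.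
  by case: (no i).
have [c cP] := choice (fun w =>
  let: ex_intro2 c c0 e := wserE w in ex_intro
    (fun c => (0 < c)%N /\ wser (D w) =1 psexp (ps1X R) c) c (conj c0 e)).
have c_gt0 w : (0 < c w)%N by case: (cP w).
have wserD w : pos_upto (wser (D w)) (c w).
  by have [_ e] := cP w; apply: eq_pos_upto e (psexp_ps1X_pos R (c w)).
move: Hab Htau Hrho1 Hrho2; set ta : R := ratr tau => Hab Htau Hrho1 Hrho2.
have [t [t' [L [L' [wl [cs [u [bt [pE qE xE]]]]]]]]] :=
  segment_bent HC Dscat wserD c_gt0 (init i0) Hsg Hns Htau.
move: bt pE qE xE; set s := size _; set l := bends_before _ _; set T := sg_len sg.
set m := fun j => nth 0 (sg_exps sg) j; set nrm := fun j => nth 0 ns j.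
move=> bt pE qE xE.
have ls := bent_l bt.
have [ta0 taT] : 0 < ta /\ ta < T by apply/andP.
have a0 : 0 < a%:R :> R by rewrite ltr0n.
have b0 : 0 < b%:R :> R by rewrite ltr0n.
pose h : R := (a + b)%N%:R.
have h0 : 0 < h by rewrite ltr0n addn_gt0 Ha.
have hab : h = a%:R + b%:R by rewrite /h natrD.
have T0 : 0 < T by lra.
have bT : b%:R * T = h * ta.
  move: Hab; rewrite -/h -/T => /eqP.
  rewrite eqr_div; [|exact: lt0r_neq0|exact: lt0r_neq0] => /eqP ->.
  by rewrite mulrC.
have lineE (x y : MR R S) (r q : R) : x - r *: y - (r - q) *: - y = x - q *: y.
  by apply/rowP => k; rewrite !mxE; ring.
(* The side towards the initial point: the bends before tau, numbered backwards, with
   a P i = a (y + t m) for the point y of the segment at time t. *)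
have [d1 [[A1 n1 P1] [nu1 wl1 cs1] f1 sg1]] : exists d : side S W,
    [/\ [/\ admissible D c d, (sd_n d <= l)%N & L (l - sd_n d)%N = L (l - l)%N],
        [/\ sd_nu d = (fun i => nrm (l - i.+1)%N),
            sd_wl d = (fun i => wl (l - i.+1)%N) &
            sd_cs d = (fun i => cs (l - i.+1)%N)],
        forall i, (i <= l)%N -> toR R (sd_f d i) = a%:R *: L (l - i)%N &
        forall i, (i < sd_n d)%N -> 0 < t (l - i.+1)%N].
  case: Hrho1 => v vE.
  have js i : (i < l)%N -> (l - i.+1 < s)%N by move=> ?; apply: leq_trans ls; lia.
  have ji i : (i < l)%N -> (l - i = (l - i.+1).+1)%N by lia.
  apply: (side_of_half Dscat (M := fun i => m (l - i)%N)
    (u := fun i => u (l - i.+1)%N) (v := v)) => //.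
  - by move=> i /js /(bent_range bt)/andP[].
  - move=> i il; have ji' : (l - i.+1 = (l - i.+2).+1)%N by lia.
    rewrite ji'; apply: (bent_mono bt _).1.
    by rewrite -ji'; apply: js; lia.
  - by move=> i il; rewrite (ji i il) -(bent_line bt) // js.
  - by move=> i /js; exact: bent_Ncirc bt _.
  - move=> i il; rewrite (ji i il) -(bent_line bt) ?js //.
    exact: (bent_perp bt (js i il)).1.
  - by move=> i il; rewrite (ji i il); apply: bent_by bt _ (js i il).
  - by move=> i w /js il wi; case: (bent_wall bt il wi).
  - rewrite subnn -pE vE; congr (toR R (_ *: _)).
    by rewrite /rho1 -/l big_add1 big_mkord.
  - by rewrite subnn -pE; apply/eqP.
(* The side towards the final point: time is counted from there, which reverses
   the exponents. *)
have [d2 [[A2 n2 P2] [nu2 wl2 cs2] f2 sg2]] : exists d : side S W,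
    [/\ [/\ admissible D c d, (sd_n d <= s - l)%N &
           L (l + sd_n d)%N - T *: toR R (m (l + sd_n d)%N) =
           L (l + (s - l))%N - T *: toR R (m (l + (s - l))%N)],
        [/\ sd_nu d = (fun i => nrm (l + i)%N),
            sd_wl d = (fun i => wl (l + i)%N) &
            sd_cs d = (fun i => cs (l + i)%N)],
        forall i, (i <= s - l)%N -> toR R (sd_f d i) =
          b%:R *: (L (l + i)%N - T *: toR R (m (l + i)%N)) &
        forall i, (i < sd_n d)%N -> 0 < T - t (l + i)%N].
  case: Hrho2 => v vE.
  have js i : (i < s - l)%N -> (l + i < s)%N by lia.
  apply: (side_of_half Dscat (sg := fun i => T - t (l + i)%N)
    (M := fun i => - m (l + i)%N)
    (P := fun i => L (l + i)%N - T *: toR R (m (l + i)%N))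
    (u := fun i => u (l + i)%N) (v := (-1) ^+ (s - l) *: v)) => //.
  - by move=> i /js /(bent_range bt)/andP[_]; rewrite subr_ge0.
  - move=> i il; rewrite lerD2l lerN2 addnS; apply: (bent_mono bt _).1.
    by rewrite -addnS; exact: js.
  - by move=> i /js il; rewrite !toRN !lineE addnS (bent_line bt).
  - by move=> i /js; exact: bent_Ncirc bt _.
  - by move=> i /js il; rewrite toRN lineE; exact: (bent_perp bt il).1.
  - move=> i /js il; rewrite addnS.
    apply: (bends_by_reverse Dscat (v := nrm (l + i)%N)) (bent_by bt il) _ => w wi.
    by case: (@bent_wall _ _ _ _ _ _ _ _ _ _ _ _ _ _ _ _ _ _ bt _ w il);
      rewrite ?inE ?wi ?orbT.
  - by move=> i w /js il wi; case: (bent_wall bt il wi).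
  - rewrite subnKC // -qE vE; congr (toR R _); rewrite scalerA; congr (_ *: _).
    rewrite /rho2 -/l -/s big_add1 big_mkord /=.
    have -> : \prod_(i < s - l) pairZ (nrm (l + i)%N) (- m (l + i.+1)%N) =
        \prod_(i < s - l) - pairZ (nrm (l + i)%N) (m (l + i.+1)%N).
      apply: eq_bigr => i _; rewrite -[- m _]sub0r pairZB.
      by rewrite (_ : pairZ _ 0 = 0) ?sub0r // /pairZ big1 // => k _;
        rewrite mxE mulr0.
    rewrite prodrN card_ord mulrC signrMK; apply: eq_bigr => i _.
    by rewrite addnS.
  - by rewrite subnKC // -qE; apply/eqP.
set x0 := L l - ta *: toR R (m l).
have [k1 k10 k1P] : exists2 k0 : R, 0 < k0 & forall ka, 0 < ka < k0 ->
    orderly D d1 (h *: x0 + ka *: (L' l - L l)).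
  have E := @deformed_orderly R S W D c C Dscat d1 A1 a%:R h ta
    (fun i => toR R (m (l - i)%N)) (fun i => L (l - i)%N) (fun i => L' (l - i)%N)
    (fun i => L (l - i.+1)%N - t (l - i.+1)%N *: toR R (m (l - i.+1)%N))
    (fun i => L' (l - i.+1)%N - t' (l - i.+1)%N *: toR R (m (l - i.+1)%N))
    (fun i => t (l - i.+1)%N) (fun i => t' (l - i.+1)%N).
  rewrite /deformed /= subn0 in E.
  have jl i : (i < sd_n d1)%N -> (l - i.+1 < l)%N by lia.
  have js i : (i < sd_n d1)%N -> (l - i.+1 < s)%N.
    by move=> /jl il; exact: leq_trans ls.
  have ji i : (i < sd_n d1)%N -> (l - i = (l - i.+1).+1)%N by lia.
  apply: E => //.
  - by move=> i il; apply: f1; exact: leq_trans n1.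
  - by move=> i il; split=> //; rewrite (ji i il) (bent_line bt) // js.
  - by move=> i il; split=> //; rewrite (ji i il) (bent_line' bt) // js.
  - by move=> i il; rewrite nu1; exact: (bent_perp bt (js i il)).
  - move=> i il; have ji' : (l - i.+1 = (l - i.+2).+1)%N by lia.
    by rewrite ji'; apply: (bent_mono bt); rewrite -ji' js // ltnW.
  - by move=> i /jl il; have := bent_before bt il; split; [exact: ltW | left].
  - move=> i w il; rewrite wl1 cs1 => wi.
    by case: (bent_wall bt (js i il) wi).
have [k2 k20 k2P] : exists2 k0 : R, 0 < k0 & forall ka, 0 < ka < k0 ->
    orderly D d2 (h *: x0 + ka *: (L' l - L l)).
  have E := @deformed_orderly R S W D c C Dscat d2 A2 b%:R h (T - ta)
    (fun i => - toR R (m (l + i)%N))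
    (fun i => L (l + i)%N - T *: toR R (m (l + i)%N))
    (fun i => L' (l + i)%N - T *: toR R (m (l + i)%N))
    (fun i => L (l + i)%N - t (l + i)%N *: toR R (m (l + i)%N))
    (fun i => L' (l + i)%N - t' (l + i)%N *: toR R (m (l + i)%N))
    (fun i => T - t (l + i)%N) (fun i => T - t' (l + i)%N).
  rewrite /deformed /= addn0 lineE in E.
  have e : L' l - T *: toR R (m l) - (L l - T *: toR R (m l)) = L' l - L l.
    by rewrite opprB addrA subrK.
  rewrite e in E.
  have js i : (i < sd_n d2)%N -> (l + i < s)%N by lia.
  apply: E => //.
  - by rewrite subr_gt0.
  - by move=> i il; apply: f2; exact: leq_trans n2.
  - by move=> i /js il; rewrite !lineE addnS (bent_line bt).
  - by move=> i /js il; rewrite !lineE addnS (bent_line' bt).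
  - by move=> i /js il; rewrite nu2; exact: (bent_perp bt il).
  - move=> i il; rewrite lerD2l lerN2 ltrD2l ltrN2 addnS.
    by apply: (bent_mono bt); rewrite -addnS; exact: js.
  - move=> i /js il; have [h1 h2] := bent_after bt (leq_addr i l) il.
    by split; [lra | right; lra].
  - move=> i w /js il; rewrite wl2 cs2 => wi.
    by case: (bent_wall bt il wi).
have [|G1 [G2 [[B1 B2 B12] E1 E2 [I1 I2] [F1 F2]]]] :=
    @pair_of_broken_lines R S C HC W D c Dscat wserD c_gt0 d1 d2 (h *: x0) A1 A2.
  move=> e e0; pose N := 1 + `|L' l - L l|.
  have N0 : 0 < N by rewrite /N ltr_pwDl.
  pose M := Num.min (e / N) (Num.min k1 k2).
  have M0 : 0 < M by rewrite !lt_min k10 k20 divr_gt0.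
  pose ka := M / 2.
  have ka0 : 0 < ka by rewrite divr_gt0.
  have kaM : ka < M by rewrite /ka; lra.
  have := kaM; rewrite !lt_min => /and3P[kae ka1 ka2].
  exists (h *: x0 + ka *: (L' l - L l)); split.
  - rewrite addrC addKr normrZ gtr0_norm //.
    move: kae; rewrite ltr_pdivlMr // => kae; apply: le_lt_trans kae.
    by rewrite ler_pM2l // /N lerDr.
  - by apply: k1P; rewrite ka0.
  - by apply: k2P; rewrite ka0.
exists G1, G2; split=> //.
- split=> //; rewrite ?E1 ?E2 -/h xE //.
  have bal (x y : MR R S) :
      a%:R *: x + b%:R *: (x - T *: y) = h *: (x - ta *: y).
    by rewrite !scalerBr !scalerA bT hab scalerDl addrA.
  by rewrite F1 F2 f1 // f2 // subn0 addn0 bal.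
- by rewrite I1 f1 // P1 subnn pE.
- by rewrite I2 f2 // P2 subnKC // qE.
Qed.
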